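(* Let $G$ be a polycyclic-by-finite group which is not polycyclic. Then there exists a nonzero projective right $\mathbb{Z}G$-module $P$ which has no nonzero finitely generated direct summand. In particular $P$ is not free.
   Context: A group is polycyclic if it has a subnormal series with cyclic factors, and polycyclic-by-finite if it has a subnormal series whose factors are cyclic or finite. *)

(* Defs.v *)
From HB Require Import structures.
From mathcomp Require Import all_boot monoid all_algebra.
Set Implicit Arguments. Unset Strict Implicit. Unset Printing Implicit Defensive.
Import GRing.Theory.

Section GroupDefs.
Variable G : groupType.
Local Open Scope group_scope.

Definition is_subgroup (H : G -> Prop) : Prop :=
  [/\ H 1, (forall x y, H x -> H y -> H (x * y)) & (forall x, H x -> H x^-1)].

Definition normal_in (K H : G -> Prop) : Prop :=
  [/\ is_subgroup K, is_subgroup H, (forall x, K x -> H x) &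
      (forall g k, H g -> K k -> K (g^-1 * k * g))].

Definition cyclic_factor (H K : G -> Prop) : Prop :=
  exists2 x, H x & forall y, H y ->
    exists k : nat, K ((x ^+ k)^-1 * y) \/ K (x ^+ k * y).

Definition finite_factor (H K : G -> Prop) : Prop :=
  exists l : seq G, (forall x, x \in l -> H x) /\
    forall y, H y -> exists2 x, x \in l & K (x^-1 * y).

Definition subnormal_series (n : nat) (S : nat -> G -> Prop) : Prop :=
  [/\ (forall g, S 0%N g), (forall g, S n g <-> g = 1) &
      (forall i, (i < n)%N -> normal_in (S i.+1) (S i))].

Definition polycyclic : Prop :=
  exists n S, subnormal_series n S /\
    forall i, (i < n)%N -> cyclic_factor (S i) (S i.+1).

Definition polycyclic_by_finite : Prop :=
  exists n S, subnormal_series n S /\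
    forall i, (i < n)%N ->
      cyclic_factor (S i) (S i.+1) \/ finite_factor (S i) (S i.+1).

End GroupDefs.

Local Open Scope ring_scope.

(* Right ZG-modules, presented as abelian groups with a right G-action by
   additive maps (m.1 = m, m.(gh) = (m.g).h); this is the same data as a
   right module over the integral group ring ZG. *)
Record rgmod (G : groupType) := RGMod {
  rgcarrier :> zmodType;
  ract : rgcarrier -> G -> rgcarrier;
  ract1 : forall m, ract m 1%g = m;
  ractM : forall m g h, ract m (g * h)%g = ract (ract m g) h;
  ractD : forall g m n, ract (m + n) g = ract m g + ract n g
}.

Section ModuleDefs.
Variable G : groupType.

Definition ghom (A B : rgmod G) (f : A -> B) : Prop :=
  (forall x y, f (x + y) = f x + f y) /\
  (forall x g, f (ract x g) = ract (f x) g).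

Definition submodule (A : rgmod G) (S : A -> Prop) : Prop :=
  [/\ S 0, (forall x y, S x -> S y -> S (x + y)), (forall x, S x -> S (- x)) &
      (forall x g, S x -> S (ract x g))].

Definition direct_summand (A : rgmod G) (Q : A -> Prop) : Prop :=
  submodule Q /\ exists Q' : A -> Prop,
    [/\ submodule Q', (forall x, Q x -> Q' x -> x = 0) &
        (forall x, exists a b, [/\ Q a, Q' b & x = a + b])].

Definition fg_submodule (A : rgmod G) (Q : A -> Prop) : Prop :=
  submodule Q /\ exists l : seq A, (forall x, x \in l -> Q x) /\
    forall S : A -> Prop, submodule S -> (forall x, x \in l -> S x) ->
      forall x, Q x -> S x.

Definition projective (P : rgmod G) : Prop :=
  forall (A B : rgmod G) (f : A -> B) (g : P -> B),
    ghom f -> (forall b, exists a, f a = b) -> ghom g ->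
    exists h : P -> A, ghom h /\ forall x, f (h x) = g x.

Definition free_module (P : rgmod G) : Prop :=
  exists B : P -> Prop, forall (M : rgmod G) (f : P -> M),
    (exists h : P -> M, ghom h /\ forall b, B b -> h b = f b) /\
    (forall h1 h2 : P -> M, ghom h1 -> ghom h2 ->
       (forall b, B b -> h1 b = h2 b) -> forall x, h1 x = h2 x).

End ModuleDefs.

(* Main.v *)
From HB Require Import structures.
From mathcomp Require Import all_boot monoid all_algebra.
From mathcomp Require Import fingroup perm action cyclic zify finmap monalg.
Require Import Defs.
From Stdlib Require Import Classical ClassicalEpsilon.
From Stdlib Require Import FunctionalExtensionality PropExtensionality.

(** Let G be virtually polycyclic and not polycyclic.  Every subgroup of G is
    finitely generated, and G is residually finite.  Going up a series with
    cyclic or finite factors, each member either is soluble or has a nontrivial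
    perfect term in its derived series or in that of a smaller member; since a
    soluble group all of whose subgroups are finitely generated is polycyclic,
    G has a nontrivial finitely generated perfect subgroup H = <h_1, ..., h_d>.

    Put x_i = h_i - 1.  As H is perfect, x_l = sum_ij b_lji x_j x_i in ZG.  On
    the free module F on all words in 1, ..., d let A w = sum_i (i w) x_i and
    B (j i v) = sum_l (l v) b_lji, with B = 0 on shorter words.  Then BAA = A,
    which makes 1 - A a split monomorphism, so P = F / (1 - A) F is projective.
    In P every word w equals sum_i (i w) x_i, so P has no nonzero homomorphism
    to the trivial module Z; in particular P is not free.

    A finitely generated direct summand of P is the image of an idempotent
    matrix over ZG which vanishes under augmentation.  To see that it is zero,
    push it forward to finite quotients: it suffices to treat an idempotent
    e = sum_g A_g g over the group ring of a finite group.  Let X be the set of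
    the g != 1 whose order has smallest prime factor p.  Since e = e^(p^k), the
    sum of tr A_g over X is a sum over words of length p^k with product in X,
    and rotating the words shows that it is divisible by arbitrarily high powers
    of p.  So tr A_g sums to 0 over g != 1, hence tr A_1 = 0 as well, and the
    matrix of e over Q is idempotent of trace 0 (this is Swan's theorem). *)

Set Implicit Arguments. Unset Strict Implicit. Unset Printing Implicit Defensive.
Import GRing.Theory Num.Theory.

(** * Subgroups and series *)

Definition asb (P : Prop) : bool :=
  if excluded_middle_informative P then true else false.

Lemma asbP (P : Prop) : reflect P (asb P).
Proof.
by rewrite /asb; case: excluded_middle_informative => h; constructor.
Qed.

Section GroupTheory.
Variable G : groupType.
Implicit Types (H K L N U : G -> Prop) (x y z g t : G).
Local Open Scope group_scope.

Definition expgz x (m : int) : G :=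
  match m with Posz n => x ^+ n | Negz n => x ^- n.+1 end.

Lemma expgzS x (m : int) : expgz x (m + 1)%R = expgz x m * x.
Proof.
case: m => [n|[|n]].
- by rewrite -PoszD addn1 /= expgSr.
- by rewrite /= mulVg.
- have -> : (Negz n.+1 + 1)%R = Negz n by lia.
  by rewrite /= [x ^+ n.+2]expgS invgM mulgVK.
Qed.

Lemma expgzB1 x (m : int) : expgz x (m - 1)%R = expgz x m * x^-1.
Proof. by rewrite -[in RHS](subrK 1%R m) expgzS mulgK. Qed.

Lemma expgzD x (m n : int) : expgz x (m + n)%R = expgz x m * expgz x n.
Proof.
elim/int_ind: n => [|n IH|n IH].
- by rewrite addr0 /= mulg1.
- have -> : (m + n.+1%:Z = m + n%:Z + 1)%R by lia.
  by rewrite expgzS IH -mulgA -expgzS; congr (_ * expgz _ _); lia.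
- have -> : (m - n.+1%:Z = m - n%:Z - 1)%R by lia.
  by rewrite expgzB1 IH -mulgA -expgzB1; congr (_ * expgz _ _); lia.
Qed.

Lemma expgzN x (m : int) : expgz x (- m)%R = (expgz x m)^-1.
Proof.
by apply/esym/mulg1_eq; rewrite -expgzD subrr.
Qed.

Section Subgroup.
Variables (H : G -> Prop) (sH : is_subgroup H).

Lemma sub1 : H 1. Proof. by case: sH. Qed.
Lemma subM x y : H x -> H y -> H (x * y). Proof. by case: sH => _ h _; apply: h. Qed.
Lemma subV x : H x -> H x^-1. Proof. by case: sH => _ _ h; apply: h. Qed.
Lemma subVE x : H x^-1 -> H x. Proof. by move/subV; rewrite invgK. Qed.
Lemma subMl x y : H x -> H (x * y) -> H y.
Proof. by move=> /subV hx /(subM hx); rewrite mulKg. Qed.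
Lemma subMr x y : H y -> H (x * y) -> H x.
Proof. by move=> /subV hy /subM /(_ hy); rewrite mulgK. Qed.
Lemma subX x n : H x -> H (x ^+ n).
Proof. by move=> hx; elim: n => [|n IH]; [apply: sub1 | rewrite expgS; apply: subM]. Qed.
Lemma subXz x m : H x -> H (expgz x m).
Proof. by case: m => n hx /=; [apply: subX | apply/subV/subX]. Qed.

End Subgroup.

Lemma subgroupI H K : is_subgroup H -> is_subgroup K ->
  is_subgroup (fun x => H x /\ K x).
Proof.
move=> sH sK; split=> [|x y [hx kx] [hy ky]|x [hx kx]].
- by split; apply: sub1.
- by split; apply: subM.
- by split; apply: subV.
Qed.

Lemma normal_conj H K g x : normal_in K H -> H g -> K x -> K (g^-1 * x * g).
Proof. by case=> _ _ _ h hg kx; apply: h. Qed.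

Lemma normal_conjV H K g x : normal_in K H -> H g -> K x -> K (g * x * g^-1).
Proof.
move=> nK hg kx; rewrite -{1}[g]invgK; apply: (normal_conj nK) => //.
by case: nK => _ sH _ _; apply: subV.
Qed.

(** Instead of forming a quotient, the right cosets of a subgroup of finite index are labelled by a
    finite type. *)
Definition coset_colouring H K (T : finType) (d : G -> T) :=
  forall x y, H x -> H y -> (d x = d y <-> K (x * y^-1)).

(** The label is the position of the first listed representative. The list speaks of left cosets and
    the labelling of right ones; normality identifies the two. *)
Lemma finite_factor_colouring H K : normal_in K H -> finite_factor H K ->
  exists (T : finType) (d : G -> T), coset_colouring H K d.
Proof.
move=> nK [l [lH lP]]; have [sK sH KH _] := nK.
pose f y := find (fun x => asb (K (x^-1 * y))) l.
have fl y : H y -> (f y < size l)%N.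
  by move=> /lP[x xl Kx]; rewrite /f -has_find; apply/hasP; exists x => //; apply/asbP.
have fK y : H y -> K ((nth 1 l (f y))^-1 * y).
  by move=> /fl; rewrite -has_find => /(nth_find 1)/asbP.
exists 'I_(size l).+1, (fun y => inord (f y)) => x y hx hy; split.
  move/(congr1 val); rewrite /= !inordK ?ltnS ?(ltnW (fl _ _)) // => e.
  have hz : H (nth 1 l (f x)) by apply/lH/mem_nth/fl.
  have := fK _ hx; have := fK _ hy; rewrite -e; set z := nth _ _ _ in hz *.
  move=> /(subV sK) ky kx; have := normal_conjV nK hz (subM sK kx ky).
  by rewrite invgM invgK !mulgA mulgV mul1g -!mulgA mulgV mulg1.
move=> kxy; congr inord; apply: eq_in_find => z zl; apply/asbP/asbP => kz.
- have := normal_conj nK hy kxy => h.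
  apply: (subMr sK (y := y^-1 * x)); last by rewrite -mulgA mulVKg.
  by move: h; rewrite -!mulgA mulVg mulg1.
- have := normal_conj nK hy kxy; rewrite -!mulgA mulVg mulg1 => h.
  by have := subM sK kz h; rewrite -mulgA mulVKg.
Qed.

(** [phi] is the exponent map onto the quotient, with kernel [K]; its values outside [H] are
    arbitrary. *)
Definition infinite_cyclic_factor H K :=
  exists t (phi : G -> int), [/\ H t, phi t = 1%R,
    (forall x y, H x -> H y -> phi (x * y) = (phi x + phi y)%R) &
    (forall x, H x -> (phi x = 0%R <-> K x))].

(** Either a positive power of the generator lies in [K], and the lower powers are representatives,
    or exponents modulo [K] are unique and define [phi]. *)
Lemma cyclic_factor_split H K : normal_in K H -> cyclic_factor H K ->
  finite_factor H K \/ infinite_cyclic_factor H K.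
Proof.
move=> nK [t ht tP]; have [sK sH KH _] := nK.
have tz y : H y -> exists m : int, K (expgz t (- m)%R * y).
  move=> /tP[k [hk|hk]]; [exists k | exists (- k%:Z)%R].
    by rewrite expgzN.
  by rewrite opprK.
case: (classic (exists2 m : nat, (0 < m)%N & K (t ^+ m))) => [[m m0 tm]|tinf].
  left; exists [seq t ^+ i | i <- iota 0 m]; split.
    by move=> x /mapP[i _ ->]; apply: subX.
  move=> y hy; have [k kP] := tz y hy.
  exists (t ^+ `|(k %% m)%Z|%N).
    by apply: map_f; rewrite mem_iota; lia.
  have km := subXz sK (k %/ m)%Z tm.
  have e : expgz t ((k %/ m)%Z * m%:Z)%R = expgz (t ^+ m) (k %/ m)%Z.
    case: (k %/ m)%Z => n; first by rewrite -PoszM [LHS]/= mulnC expgnA.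
    by rewrite NegzE mulNr !expgzN -PoszM /= mulnC expgnA.
  have -> : (t ^+ `|(k %% m)%Z|%N)^-1 = expgz t ((k %/ m)%Z * m%:Z)%R * expgz t (- k)%R.
    rewrite -expgzD -[_^-1](expgzN t `|(k %% m)%Z|%N); congr expgz.
    have := divz_eq k m; have : (0 <= k %% m)%Z%R by rewrite modz_ge0; lia.
    lia.
  by rewrite -mulgA e; apply: subM.
right.
have tz0 m : K (expgz t m) -> m = 0%R.
  case: m => [[|n]|n] //= h; case: tinf; exists n.+1 => //.
  exact: subVE.
pose phi y : int := epsilon (inhabits 0%R) (fun m => K (expgz t (- m)%R * y)).
have phiP y : H y -> K (expgz t (- phi y)%R * y).
  by move=> /tz h; apply: epsilon_spec h.
have phiE y m : H y -> K (expgz t (- m)%R * y) -> phi y = m.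
  move=> hy hm; have /(subV sK) h := phiP y hy; have := subM sK hm h.
  rewrite invgM mulgA mulgK -expgzN -expgzD => /tz0; lia.
exists t, phi; split=> //.
- by apply: phiE => //=; rewrite mulVg; apply: sub1.
- move=> x y hx hy; apply: phiE; first exact: subM.
  have := subM sK (normal_conj nK (subXz sH (phi y) ht) (phiP x hx)) (phiP y hy).
  rewrite -!expgzN -!mulgA (mulgA (expgz t (phi y))) -expgzD subrr /= mul1g.
  by rewrite mulgA -expgzD -opprD [(phi y + _)%R]addrC.
- move=> x hx; split=> [e|kx]; first by have := phiP x hx; rewrite e /= ?oppr0 mul1g.
  by apply: phiE => //; rewrite oppr0 mul1g.
Qed.

Lemma infinite_cyclic_phiX H t (phi : G -> int) m : is_subgroup H -> H t -> phi t = 1%R ->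
  (forall x y, H x -> H y -> phi (x * y) = (phi x + phi y)%R) ->
  phi (expgz t m) = m.
Proof.
move=> sH ht p1 pD.
have p0 : phi 1 = 0%R by have := pD _ _ (sub1 sH) (sub1 sH); rewrite mulg1; lia.
elim/int_ind: m => [//|n IH|n IH].
  have -> : (n.+1%:Z = n%:Z + 1)%R by lia.
  by rewrite expgzS pD ?IH ?p1 //; apply: subXz.
have h : H (expgz t (- n.+1%:Z)%R) by apply: subXz.
have := pD _ _ h ht; rewrite -expgzS p1.
have -> : (- n.+1%:Z + 1 = - n%:Z)%R by lia.
rewrite IH; lia.
Qed.

(** The induction climbs from the trivial end of the series. *)
Lemma series_ind (P : (G -> Prop) -> Prop) :
  (forall H, is_subgroup H -> (forall x, H x -> x = 1) -> P H) ->
  (forall H K, normal_in K H -> finite_factor H K \/ infinite_cyclic_factor H K ->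
     P K -> P H) ->
  polycyclic_by_finite G -> exists H, (forall g, H g) /\ P H.
Proof.
move=> P1 PS [n [S [[S0 Sn nS] fS]]]; exists (S 0%N); split=> //.
have h j : (j <= n)%N -> P (S (n - j)%N).
  elim: j => [_|j IH jn].
    rewrite subn0; apply: P1 => [|x /Sn //].
    split=> [|x y /Sn-> /Sn->|x /Sn->]; apply/Sn; rewrite ?mulg1 ?invg1 //.
  have lt : (n - j.+1 < n)%N by lia.
  have e : (n - j.+1).+1 = (n - j)%N by lia.
  have := nS _ lt; have := fS _ lt; rewrite e => fj nj.
  apply: (PS _ _ nj _ (IH (ltnW jn))).
  by case: fj => [/(cyclic_factor_split nj)//|]; left.
by have := h n (leqnn n); rewrite subnn.
Qed.

End GroupTheory.

(** * Finite generation of all subgroups *)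

Section Noetherian.
Variable G : groupType.
Implicit Types (H K L N U : G -> Prop) (x y z g t : G).
Local Open Scope ring_scope.
Local Open Scope group_scope.

Inductive mgen (l : seq G) : G -> Prop :=
| mgen1 : mgen l 1
| mgenM x g : mgen l x -> g \in l -> mgen l (x * g).

Definition fgen H := exists l, (forall g, g \in l -> H g) /\ forall x, H x -> mgen l x.

Definition noetherian H :=
  forall U, is_subgroup U -> (forall x, U x -> H x) -> fgen U.

Lemma mgen_sub (l1 l2 : seq G) x : {subset l1 <= l2} -> mgen l1 x -> mgen l2 x.
Proof.
move=> l12; elim=> [|y g _ IH gl]; first exact: mgen1.
exact: mgenM IH (l12 _ gl).
Qed.

Lemma mgen_mul l x y : mgen l x -> mgen l y -> mgen l (x * y).
Proof.
move=> hx; elim=> [|z g _ IH gl]; first by rewrite mulg1.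
by rewrite mulgA; apply: mgenM.
Qed.

Lemma mgen_mem l x : x \in l -> mgen l x.
Proof. by move=> xl; rewrite -[x]mul1g; apply: mgenM xl; apply: mgen1. Qed.

Lemma mgen_exp l x n : mgen l x -> mgen l (x ^+ n).
Proof.
move=> hx; elim: n => [|n IH]; first exact: mgen1.
by rewrite expgS; apply: mgen_mul.
Qed.

Lemma noetherian1 H : is_subgroup H -> (forall x, H x -> x = 1) -> noetherian H.
Proof.
by move=> _ h1 U sU UH; exists [::]; split=> // x /UH/h1->; apply: mgen1.
Qed.

(** Generators of the intersection of [U] with [K], and one element of [U] from each coset that [U]
    meets, generate [U]. *)
Lemma noetherian_finite H K : normal_in K H -> finite_factor H K ->
  noetherian K -> noetherian H.
Proof.
move=> nK fK noK U sU UH; have [sK sH KH _] := nK.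
have [T [d dP]] := finite_factor_colouring nK fK.
have [||l0 [l0U l0g]] := noK (fun x => U x /\ K x).
- exact: subgroupI.
- by move=> x [].
(* A coset that [U] misses receives an arbitrary element of [U], so [r] always lands in [U]. *)
pose r (c : T) := epsilon (inhabits 1) (fun x => U x /\ ((exists y, U y /\ d y = c) -> d x = c)).
have rP c : U (r c) /\ ((exists y, U y /\ d y = c) -> d (r c) = c).
  apply: (epsilon_spec (inhabits 1) (fun x => U x /\ ((exists y, U y /\ d y = c) -> d x = c))).
  case: (classic (exists y, U y /\ d y = c)) => [[y [hy yc]]|nex].
    by exists y; split.
  by exists 1; split=> [|/nex//]; apply: sub1.
exists (l0 ++ [seq r c | c <- enum T]); split=> [g|x hx].
  rewrite mem_cat => /orP[/l0U[]//|/mapP[c _ ->]]; exact: (rP c).1.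
have [rU /(_ (ex_intro _ x (conj hx erefl))) rd] := rP (d x).
have kx : K (x * (r (d x))^-1) by apply/dP => //; apply: UH.
rewrite -[x](mulgVK (r (d x))); apply: mgen_mul.
  apply: (@mgen_sub l0) => [z zl|]; first by rewrite mem_cat zl.
  by apply: l0g; split=> //; apply: subM => //; apply: subV.
by apply: mgen_mem; rewrite mem_cat map_f ?orbT ?mem_enum.
Qed.

(** If [phi] is not zero on [U], its least positive value there is attained at some [v], and [U] is
    generated by [v], its inverse and the intersection of [U] with [K]. *)
Lemma noetherian_cyclic H K : normal_in K H -> infinite_cyclic_factor H K ->
  noetherian K -> noetherian H.
Proof.
move=> nK [t [phi [ht p1 pD pK]]] noK U sU UH; have [sK sH KH _] := nK.
have [||l0 [l0U l0g]] := noK (fun x => U x /\ K x).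
- exact: subgroupI.
- by move=> x [].
have pV x : H x -> phi x^-1 = (- phi x)%R.
  move=> hx; have := pD _ _ hx (subV sH hx); rewrite mulgV.
  have /(pK _ (sub1 sH)) -> := sub1 sK; lia.
case: (classic (exists2 u, U u & phi u <> 0%R)) => [[u hu pu]|noU]; last first.
  exists l0; split=> [g /l0U[]//|x hx].
  apply: l0g; split=> //; apply/pK; first exact: UH.
  by apply: NNPP => h; apply: noU; exists x.
pose P n := asb (exists2 v, U v & phi v = n.+1%:Z).
have exP : exists n, P n.
  exists `|phi u|%N.-1; apply/asbP.
  case: (ltrP 0%R (phi u)) => h; [exists u | exists (u^-1)] => //.
  - lia.
  - exact: subV.
  - by rewrite pV; [lia|apply: UH].
have [n /asbP[v hv pv] nmin] := ex_minnP exP.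
exists (l0 ++ [:: v; v^-1]); split=> [g|x hx].
  rewrite mem_cat !inE => /orP[/l0U[]//|/orP[]/eqP->//]; exact: subV.
(* Division with remainder: dividing [x] by the [q]-th power of [v] leaves a value of [phi] below
   the minimum, hence zero. *)
pose q := (phi x %/ n.+1%:Z)%Z.
have pvq : phi (expgz v q) = (q * n.+1%:Z)%R.
  rewrite /q; elim/int_ind: (_ %/ _)%Z => [|k IH|k IH].
  - by rewrite mul0r; apply/pK; apply: sub1.
  - have -> : (k.+1%:Z = k%:Z + 1)%R by lia.
    rewrite expgzS pD ?IH ?pv; [lia| |exact: UH].
    by apply: subXz => //; apply: UH.
  - have -> : (- k.+1%:Z = - k%:Z - 1)%R by lia.
    rewrite expgzB1 pD ?pV ?IH ?pv; [lia|exact: UH| |by apply: subV => //; apply: UH].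
    by apply: subXz => //; apply: UH.
have hq : U (expgz v q) by apply: subXz.
have hy : U (x * (expgz v q)^-1) by apply: subM => //; apply: subV.
have py : phi (x * (expgz v q)^-1) = (phi x %% n.+1%:Z)%Z.
  rewrite pD ?pV ?pvq; [|exact: UH|exact: UH|by apply: subV => //; apply: UH].
  by rewrite {1}(divz_eq (phi x) n.+1) -/q addrAC subrr add0r.
have p0 : phi (x * (expgz v q)^-1) = 0%R.
  have h0 : (0 <= (phi x %% n.+1%:Z)%Z)%R by rewrite modz_ge0.
  have h1 : ((phi x %% n.+1%:Z)%Z < n.+1%:Z)%R by rewrite ltz_pmod.
  case e : (phi x %% n.+1%:Z)%Z => [[|k]|k]; rewrite e in py h0 h1 => //.
  have : (n <= k)%N by apply: nmin; apply/asbP; exists (x * (expgz v q)^-1).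
  lia.
have ky : K (x * (expgz v q)^-1) by apply/pK => //; apply: UH.
rewrite -[x](mulgVK (expgz v q)); apply: mgen_mul.
  by apply: (@mgen_sub l0) => [z zl|]; [rewrite mem_cat zl | apply: l0g].
by case: (q) => k /=; rewrite -?expVgn; apply/mgen_exp/mgen_mem;
  rewrite mem_cat !inE eqxx ?orbT.
Qed.

End Noetherian.

(** * Residual finiteness *)

Section ResiduallyFinite.
Variable G : groupType.
Implicit Types (H K L N U : G -> Prop) (x y z g t : G).
Local Open Scope ring_scope.
Local Open Scope group_scope.

Definition right_congruence H (T : finType) (c : G -> T) :=
  forall x y g, H x -> H y -> H g -> c x = c y -> c (x * g) = c (y * g).

(* Finite right congruences on H correspond to finite index subgroups of H:
   the class of 1 is a subgroup of index at most #|T|. *)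
Definition residually_finite H :=
  forall x, H x -> x <> 1 ->
    exists (T : finType) (c : G -> T), right_congruence H c /\ c x <> c 1.

Lemma coset_right_congruence H K (T : finType) (d : G -> T) :
  is_subgroup H -> coset_colouring H K d -> right_congruence H d.
Proof.
move=> sH dP x y g hx hy hg /dP-/(_ hx hy) k.
by apply/dP; [exact: subM|exact: subM|rewrite invgM !mulgA mulgK].
Qed.

Lemma residually_finite1 H : is_subgroup H -> (forall x, H x -> x = 1) ->
  residually_finite H.
Proof. by move=> _ h x /h. Qed.

(** A point outside [K] is separated by its coset. Otherwise a congruence on [K] is induced up to
    [H]: the label of [y] is its coset together with the class of [y] divided by the coset
    representative. *)
Lemma residually_finite_finite H K : normal_in K H -> finite_factor H K ->
  residually_finite K -> residually_finite H.
Proof.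
move=> nK fK rK x hx x1; have [sK sH KH _] := nK.
have [T [d dP]] := finite_factor_colouring nK fK.
have dR := coset_right_congruence sH dP.
have h1 := sub1 sH.
case: (classic (K x)) => kx; last first.
  exists T, d; split=> // /dP-/(_ hx h1); rewrite invg1 mulg1 //.
have [T' [c [cR cx]]] := rK x kx x1.
pose r (b : T) := epsilon (inhabits 1) (fun y => H y /\ d y = b).
have rP y : H y -> H (r (d y)) /\ d (r (d y)) = d y.
  by move=> hy; apply: (epsilon_spec (inhabits 1) (fun z => H z /\ d z = d y)); exists y.
have rK' y : H y -> K (y * (r (d y))^-1).
  by move=> hy; have [h e] := rP y hy; apply/dP.
exists (T * T')%type, (fun y => (d y, c (y * (r (d y))^-1))); split.
  move=> y z g hy hz hg [dyz cyz].
  have dg := dR _ _ _ hy hz hg dyz.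
  rewrite /= dg; congr (_, _).
  pose s := r (d z); pose s' := r (d (z * g)).
  have [hs _] := rP z hz; have hzg := subM sH hz hg; have [hs' _] := rP _ hzg.
  (* Schreier's factorisation: passing from [w] to [w * g] multiplies the component in [K] by
     [s * g * s'^-1], the same element of [K] for [y] and [z]. *)
  have e w : w * g * s'^-1 = (w * s^-1) * (s * g * s'^-1).
    by rewrite !mulgA mulgVK.
  rewrite -/s' (e y) (e z); apply: cR.
  - by rewrite /s -dyz; apply: rK'.
  - exact: rK'.
  - apply: (subMl sK (x := z * s^-1)); first exact: rK'.
    by rewrite -e; apply: rK'.
  - by rewrite /s -{1}dyz.
move=> [e]; rewrite e mul1g => e2; apply: cx.
have k0 : K (r (d 1)) by apply: subVE => //; rewrite -[_^-1]mul1g; apply: rK'.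
have := cR _ _ (r (d 1)) _ _ k0 e2; rewrite mulgVK mulVg; apply.
  by apply: subM => //; apply: subV.
exact: subV.
Qed.

Lemma nat_pigeonhole (T : finType) (f : nat -> T) : exists i j, (i < j)%N /\ f i = f j.
Proof.
pose g (i : 'I_#|T|.+1) := f i.
have /injectivePn[i [j ij e]] : ~~ injectiveb g.
  apply/injectiveP => /leq_card; rewrite card_ord; lia.
case: (ltngtP i j) => [lt|lt|/val_inj e']; [by exists i, j|by exists j, i|].
by rewrite e' eqxx in ij.
Qed.

(* A right congruence is determined by the class of 1 and the action of the
   generators on classes, so only finitely many have a given number of classes. *)
Lemma right_congruence_conj_period K (T : finType) (c : G -> T) t :
  is_subgroup K -> fgen K -> (forall m x, K x -> K (expgz t m * x * (expgz t m)^-1)) ->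
  right_congruence K c ->
  exists m, (0 < m)%N /\ forall x, K x -> c x = c (t ^+ m * x * t ^- m).
Proof.
move=> sK [l [lK lg]] Kt cR.
pose ct i x := c (t ^+ i * x * t ^- i).
(* The transition table of the congruence conjugated by [t ^+ i]: a class and a generator give the
   class of the product. Unattained classes get an arbitrary value. *)
pose dlt i : {ffun T * 'I_(size l) -> T} := [ffun p : T * 'I_(size l) =>
  epsilon (inhabits p.1) (fun s => exists2 x, K x & ct i x = p.1 /\ s = ct i (x * l`_p.2))].
have dltP i x (n : 'I_(size l)) : K x -> dlt i (ct i x, n) = ct i (x * l`_n).
  move=> kx; rewrite ffunE /=.
  set Q := fun s => _; have : exists s, Q s by exists (ct i (x * l`_n)), x.
  move=> /(epsilon_spec (inhabits (ct i x)) Q) [y ky [e ->]].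
  have cj z : t ^+ i * (z * l`_n) * t ^- i = (t ^+ i * z * t ^- i) * (t ^+ i * l`_n * t ^- i).
    by rewrite !mulgA mulgVK.
  rewrite /ct !cj; apply: cR => //; try exact: (Kt i).
  by apply: (Kt i); apply/lK/mem_nth.
have [i [j [ij e]]] := nat_pigeonhole dlt.
(* Equal tables force equal congruences, by induction on a word in the generators. *)
have cij x : K x -> ct i x = ct j x.
  move=> kx; have : K x by []. 
  elim: (lg x kx) => [_|y g _ IH gl kyg]; first by rewrite /ct !mulg1 !mulgV.
  have kg := lK _ gl; have ky := subMr sK kg kyg.
  have lt : (index g l < size l)%N by rewrite index_mem.
  have := dltP i y (Ordinal lt) ky; have := dltP j y (Ordinal lt) ky.
  by rewrite e IH //= nth_index // => -> ->.
exists (j - i)%N; split=> [|x kx]; first by rewrite subn_gt0.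
have kx' : K (t ^- i * x * t ^+ i).
  by have := Kt (- i%:Z)%R x kx; rewrite expgzN invgK.
have := cij _ kx'; rewrite /ct !mulgA mulgV mul1g -(mulgA x) mulgV mulg1 => ->.
have -> : t ^+ j = t ^+ (j - i) * t ^+ i by rewrite -expgnDr subnK // ltnW.
by rewrite invgM !mulgA !(mulgK, =^~ (mulgA _ (t ^+ i) (t ^- i)), mulgV, mulg1).
Qed.

(** If [phi x] is nonzero, a residue of [phi] separates [x]. Otherwise a congruence [c] on [K]
    separates [x], and conjugation by some positive power of [t] preserves [c]; the label records
    [phi] modulo that exponent and the class of the component in [K]. *)
Lemma residually_finite_cyclic H K : normal_in K H -> infinite_cyclic_factor H K ->
  fgen K -> residually_finite K -> residually_finite H.
Proof.
move=> nK [t [phi [ht p1 pD pK]]] fgK rK x hx x1; have [sK sH KH _] := nK.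
have h1 := sub1 sH.
have p0 : phi 1 = 0%R by apply/pK => //; apply: sub1.
pose md (m : nat) y : 'I_m.+1 := inord `|(phi y %% m.+1)%Z|%N.
have mdP m y z : md m y = md m z -> (phi y = phi z %[mod m.+1])%Z.
  move/(congr1 val); have := @modz_ge0 (phi y) m.+1 isT.
  have := @modz_ge0 (phi z) m.+1 isT; have := @ltz_pmod (phi y) m.+1 isT.
  have := @ltz_pmod (phi z) m.+1 isT.
  rewrite /= => a b c d; rewrite !inordK; lia.
have mdR m : right_congruence H (md m).
  move=> y z g hy hz hg /mdP e; rewrite /md !pD //.
  by rewrite -modzDml e modzDml.
case: (classic (phi x = 0%R)) => [/pK-/(_ hx) kx|px]; last first.
  (* The modulus is one more than the absolute value of [phi x], too large to divide it. *)
  exists _, (md `|phi x|%N); split; first exact: mdR.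
  move=> /mdP; rewrite p0 mod0z => /dvdz_mod0P; rewrite dvdzE => /dvdn_leq /=; lia.
have [T [c [cR cx]]] := rK x kx x1.
have tzH m : H (expgz t m) by apply: subXz.
have Kt m y : K y -> K (expgz t m * y * (expgz t m)^-1).
  by move=> ky; apply: (normal_conjV nK).
have [m [m0 cm]] := right_congruence_conj_period sK fgK Kt cR.
case: m m0 cm => // m _ cm.
have conjz (a b : int) y : expgz t (a + b)%R * y * (expgz t (a + b)%R)^-1 =
    expgz t a * (expgz t b * y * (expgz t b)^-1) * (expgz t a)^-1.
  by rewrite expgzD invgM !mulgA.
have cmz (k : int) y : K y -> c y = c (expgz t (k * m.+1%:Z)%R * y * (expgz t (k * m.+1%:Z)%R)^-1).
  elim/int_ind: k y => [|k IH|k IH] y ky.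
  - by rewrite mul0r /= invg1 mulg1 mul1g.
  - have -> : (k.+1%:Z * m.+1%:Z = k%:Z * m.+1%:Z + m.+1%:Z)%R by lia.
    rewrite conjz -IH; last exact: (Kt m.+1).
    exact: cm.
  - have -> : (- k.+1%:Z * m.+1%:Z = - k%:Z * m.+1%:Z - m.+1%:Z)%R by lia.
    rewrite conjz -IH; last exact: Kt.
    rewrite [RHS]cm; last exact: Kt.
    by rewrite expgzN invgK /= !mulgA mulgV mul1g -mulgA mulgV mulg1.
pose ct y := c (y * (expgz t (phi y))^-1).
have kt y : H y -> K (y * (expgz t (phi y))^-1).
  move=> hy; apply/pK; first by apply: subM => //; apply: subV.
  rewrite pD //; last exact: subV.
  rewrite -expgzN (infinite_cyclic_phiX _ sH ht p1 pD); lia.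
exists ('I_m.+1 * T)%type, (fun y => (md m y, ct y)); split; last first.
  have px : phi x = 0%R by apply/pK.
  by move=> [_]; rewrite /ct p0 px /= invg1 !mulg1.
move=> y z g hy hz hg [mdyz]; rewrite (mdR m y z g) // /ct => cyz; congr (_, _).
have /eqP := mdP _ _ _ mdyz; rewrite eqz_mod_dvd => /dvdzP[q qP].
set a := phi y in cyz qP *; set b := phi z in cyz qP *.
have ea : a = (q * m.+1%:Z + b)%R by lia.
set k := y * _ in cyz; set k' := z * _ in cyz.
have kk : K k := kt _ hy. have kk' : K k' := kt _ hz.
set u := g * (expgz t (phi g))^-1; have ku : K u := kt _ hg.
have split w : H w -> w * g * (expgz t (phi (w * g)))^-1 =
    (w * (expgz t (phi w))^-1) * (expgz t (phi w) * u * (expgz t (phi w))^-1).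
  move=> hw; rewrite pD // expgzD invgM /u !mulgA.
  by rewrite mulgVK.
rewrite !split // -/a -/b -/k -/k'.
pose v := expgz t b * u * (expgz t b)^-1; have kv : K v by apply: Kt.
pose s := expgz t (q * m.+1%:Z)%R.
have -> : expgz t a * u * (expgz t a)^-1 = s * v * s^-1.
  by rewrite ea expgzD invgM /s /v !mulgA.
rewrite -/v.
have kv' : K (s * v * s^-1) by apply: Kt.
rewrite (cR _ _ _ kk kk' kv' cyz).
have kc : K (s^-1 * k' * s).
  by rewrite -{2}[s]invgK /s -expgzN; apply: Kt.
(* Conjugation by [s] preserves [c], so [s] can be moved from [v] to [k'] and then removed. *)
have e1 : c (k' * (s * v * s^-1)) = c (s^-1 * k' * s * v).
  by rewrite (cmz q _ (subM sK kc kv)) -/s !mulgA mulgV mul1g.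
have e2 : c (s^-1 * k' * s) = c k'.
  by rewrite (cmz q _ kc) -/s !mulgA mulgV mul1g mulgK.
by rewrite e1; apply: cR.
Qed.

End ResiduallyFinite.

(** * Derived series, perfect subgroups and polycyclicity *)

Section Solvable.
Variable G : groupType.
Implicit Types (H K L N U : G -> Prop) (x y z g t : G).
Local Open Scope group_scope.

Inductive derived H : G -> Prop :=
| derived1 : derived H 1
| derivedM x a b : derived H x -> H a -> H b -> derived H (x * [~ a, b]).

Definition dseries H n := iter n derived H.

Definition soluble H := exists n, forall x, dseries H n x -> x = 1.

Definition perfect U := is_subgroup U /\ forall x, U x -> derived U x.

Lemma derived_sub H x : is_subgroup H -> derived H x -> H x.
Proof.
move=> sH; elim=> [|y a b _ hy ha hb]; first exact: sub1.
by rewrite /commg /conjg; do !apply: subM => //; apply: subV.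
Qed.

Lemma derived_comm H a b : H a -> H b -> derived H [~ a, b].
Proof. by move=> ha hb; rewrite -[[~ a, b]]mul1g; apply: derivedM => //; apply: derived1. Qed.

Lemma derived_subgroup H : is_subgroup (derived H).
Proof.
have dM x y : derived H x -> derived H y -> derived H (x * y).
  move=> hx; elim=> [|z a b _ IH ha hb]; first by rewrite mulg1.
  by rewrite mulgA; apply: derivedM.
split=> [|//|x]; first exact: derived1.
elim=> [|z a b _ IH ha hb]; first by rewrite invg1; apply: derived1.
by rewrite invgM invgR; apply: dM => //; apply: derived_comm.
Qed.

Lemma derived_mono H U x : (forall y, H y -> U y) -> derived H x -> derived U x.
Proof.
move=> HU; elim=> [|y a b _ hy ha hb]; first exact: derived1.
by apply: derivedM => //; apply: HU.
Qed.

Lemma derived_conj N x g : (forall y, N y -> N (y ^ g)) -> derived N x -> derived N (x ^ g).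
Proof.
move=> Ng; elim=> [|y a b _ hy ha hb]; first by rewrite conj1g; apply: derived1.
by rewrite conjMg conjRg; apply: derivedM => //; apply: Ng.
Qed.

Lemma normal_in_derived H N : normal_in N H -> normal_in (derived N) H.
Proof.
move=> [sN sH NH nN]; split=> //; first exact: derived_subgroup.
  by move=> x /(derived_sub sN)/NH.
move=> g k hg; rewrite -mulgA; apply: derived_conj => // y.
by rewrite /conjg mulgA; apply: nN.
Qed.

Lemma normal_in_refl H : is_subgroup H -> normal_in H H.
Proof. by move=> sH; split=> // g k hg hk; do !apply: subM => //; apply: subV. Qed.

Lemma normal_in_dseries H n : is_subgroup H -> normal_in (dseries H n) H.
Proof.
by move=> sH; elim: n => [|n IH]; [apply: normal_in_refl | apply: normal_in_derived].
Qed.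

Lemma dseries_subgroup H n : is_subgroup H -> is_subgroup (dseries H n).
Proof. by move=> sH; case: (normal_in_dseries n sH). Qed.

Lemma dseriesD H m n : dseries H (m + n) = dseries (dseries H n) m.
Proof. exact: iterD. Qed.

Lemma dseries_le H m n x : is_subgroup H -> (m <= n)%N -> dseries H n x -> dseries H m x.
Proof.
move=> sH /subnK <-; rewrite dseriesD; have := dseries_subgroup m sH.
by move=> /(normal_in_dseries (n - m)) [_ _ h _] /h.
Qed.

Lemma dseries_mono H U n x : (forall y, H y -> U y) -> dseries H n x -> dseries U n x.
Proof.
by move=> HU; elim: n x => [|n IH] x; [apply: HU | apply: derived_mono => y /IH].
Qed.

(** [A] lies in the product [B N]: for normal [N] this is containment of the images modulo [N]. *)
Definition sub_mod N (A B : G -> Prop) := forall x : G, A x -> exists2 b, B b & N (b^-1 * x).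

Lemma sub_mod_comm H N a b c d : normal_in N H -> H a -> H b -> H c -> H d ->
  N (a^-1 * c) -> N (b^-1 * d) -> N ([~ a, b]^-1 * [~ c, d]).
Proof.
move=> nN; have [sN sH _ _] := nN => ha hb hc hd hac hbd.
have mm x y z w : H x -> H y -> H z -> H w -> N (x^-1 * y) -> N (z^-1 * w) ->
    N ((x * z)^-1 * (y * w)).
  move=> hx hy hz hw xy zw.
  have := subM sN (normal_conj nN hz xy) zw.
  by rewrite invgM -!mulgA mulVKg.
have mv x y : H x -> H y -> N (x^-1 * y) -> N (x^-1^-1 * y^-1).
  move=> hx hy xy; have := normal_conjV nN hx (subV sN xy).
  by rewrite invgM !invgK -!mulgA mulgV mulg1.
have hV := subV sH; have hM := subM sH.
by rewrite /commg /conjg; do ![apply: (mm)|apply: (mv)|apply: (hM)|apply: (hV)|done].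
Qed.

Lemma sub_mod_derived H N A B : normal_in N H ->
  (forall x, A x -> H x) -> (forall x, B x -> H x) ->
  sub_mod N A B -> sub_mod N (derived A) (derived B).
Proof.
move=> nN AH BH AB x; have [sN sH NH _] := nN.
have dH C y : (forall x, C x -> H x) -> derived C y -> H y.
  by move=> CH /(derived_mono CH); apply: derived_sub.
elim=> [|y a b dy [b0 hb0 hy] ha hb].
  by exists 1; [exact: derived1|rewrite invg1 mulg1; apply: sub1].
have [a1 ha1 k1] := AB _ ha; have [b1 hb1 k2] := AB _ hb.
exists (b0 * [~ a1, b1]); first exact: derivedM.
have hc := sub_mod_comm nN (BH _ ha1) (BH _ hb1) (AH _ ha) (AH _ hb) k1 k2.
have hcH : H [~ a1, b1] by apply: (dH B) => //; apply: derived_comm.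
move: (commg a1 b1) (commg a b) hc hcH => u v hc hu.
have := subM sN (normal_conj nN hu hy) hc.
by rewrite invgM -!mulgA mulVKg.
Qed.

Lemma sub_mod_dseries H N A B n : normal_in N H ->
  is_subgroup A -> is_subgroup B ->
  (forall x, A x -> H x) -> (forall x, B x -> H x) ->
  sub_mod N A B -> sub_mod N (dseries A n) (dseries B n).
Proof.
move=> nN sA sB AH BH AB; elim: n => [//|n IH].
apply: (sub_mod_derived nN) => // x.
- by move/(dseries_le (m := 0) sA (leq0n n))/AH.
- by move/(dseries_le (m := 0) sB (leq0n n))/BH.
Qed.

Lemma sub_mod_trans N A B C : is_subgroup N -> sub_mod N A B -> sub_mod N B C -> sub_mod N A C.
Proof.
move=> sN AB BC x /AB[b /BC[c hc cb] bx]; exists c => //.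
by have := subM sN cb bx; rewrite -mulgA mulVKg.
Qed.

Definition has_perfect H := exists U x, [/\ perfect U, forall y, U y -> H y, U x & x <> 1].

(* Modulo K the derived series of H becomes stationary, say from step m on;
   then H^(m) is contained in K H^(m + j + 1), and if K^(j) = 1 taking j-th
   derived subgroups gives that H^(m + j) is contained in H^(m + j + 1). *)
Lemma soluble_finite H K : normal_in K H -> finite_factor H K ->
  soluble K \/ has_perfect K -> soluble H \/ has_perfect H.
Proof.
move=> nK fK; have [sK sH KH _] := nK.
case=> [[j Kj]|[U [x [pU UK Ux x1]]]]; last first.
  by right; exists U, x; split=> // y /UK/KH.
have [T [d dP]] := finite_factor_colouring nK fK.
have dH n x : dseries H n x -> H x by apply: (dseries_le (m := 0) sH (leq0n n)).
(* The image of the n-th derived subgroup in the finite quotient by [K]. These images decrease, so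
   two consecutive ones agree. *)
pose im n := [set c : T | asb (exists2 x, dseries H n x & d x = c)].
have [m mP] : exists m, im m = im m.+1.
  apply: NNPP => h; have lt n : (#|im n.+1| < #|im n|)%N.
    apply: proper_card; rewrite properEneq; apply/andP; split.
      by apply/negP => /eqP e; apply: h; exists n.
    apply/subsetP => c; rewrite !inE => /asbP[x hx <-]; apply/asbP; exists x => //.
    exact: (dseries_le sH (leqnSn n) hx).
  have le n : (#|im n| + n <= #|im 0%N|)%N.
    by elim: n => [|n IH]; [rewrite addn0 | have := lt n; lia].
  have := le #|im 0%N|.+1; lia.
have st1 : sub_mod K (dseries H m) (dseries H m.+1).
  move=> x hx; have : d x \in im m by rewrite inE; apply/asbP; exists x.
  rewrite mP inE => /asbP[y hy e]; exists y => //.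
  have /dP k := esym e; have := normal_conj nK (dH _ _ hy) (k (dH _ _ hx) (dH _ _ hy)).
  by rewrite -!mulgA mulVg mulg1.
have st i : sub_mod K (dseries H m) (dseries H (m + i)).
  elim: i => [|i IH].
    by rewrite addn0 => x hx; exists x => //; rewrite mulVg; apply: sub1.
  apply: (sub_mod_trans sK IH); rewrite addnS -addSn ![(_ + i)%N]addnC !dseriesD.
  apply: (sub_mod_dseries nK _ _ _ _ st1) => [||x /dH//|x /dH//];
    exact: dseries_subgroup.
pose n := (m + j)%N.
have nN := normal_in_dseries n.+1 sH; have [sN _ _ _] := nN.
have HKN : sub_mod (dseries H n.+1) (dseries H m) K.
  move=> x hx; have [y hy k] := st j.+1 x hx; rewrite addnS -/n in hy.
  have hyH := dH _ _ hy.
  (* The witness is [x * y^-1], an element of [K]; this exchanges [K] and the derived subgroup as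
     containing group and modulus. *)
  exists (y * (y^-1 * x) * y^-1); first by apply: (normal_conjV nK).
  by rewrite mulVKg invgM invgK mulgVK.
have key x : dseries H n x -> dseries H n.+1 x.
  rewrite {1}/n addnC dseriesD => hx.
  have [|y /Kj->] := sub_mod_dseries nN (dseries_subgroup m sH) sK _ KH HKN hx.
    by move=> y /dH.
  by rewrite invg1 mul1g.
case: (classic (exists2 x, dseries H n x & x <> 1)) => [[x hx x1]|h]; last first.
  by left; exists n => x hx; apply: NNPP => x1; apply: h; exists x.
right; exists (dseries H n), x; split=> //; first by split=> //; apply: dseries_subgroup.
exact: dH.
Qed.

(** The quotient is abelian, so the derived subgroup of [H] lies in [K]. *)
Lemma soluble_cyclic H K : normal_in K H -> infinite_cyclic_factor H K ->
  soluble K \/ has_perfect K -> soluble H \/ has_perfect H.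
Proof.
move=> [sK sH KH _] [t [phi [_ _ pD pK]]].
case=> [[j Kj]|[U [x [pU UK Ux x1]]]]; last first.
  by right; exists U, x; split=> // y /UK/KH.
left; exists j.+1 => x hx; apply: Kj; move: hx; rewrite -addn1 dseriesD.
apply: dseries_mono => y; elim=> [|z a b _ kz ha hb]; first exact: sub1.
apply: (subM sK kz); apply/pK; first by apply: derived_sub => //; apply: derived_comm.
have pV g : H g -> phi g^-1 = (- phi g)%R.
  move=> hg; have := pD _ _ hg (subV sH hg); rewrite mulgV.
  have /(pK _ (sub1 sH)) -> := sub1 sK; lia.
have hV := subV sH; have hM := subM sH.
by rewrite /commg /conjg (pD a^-1) ?(pD b^-1) ?(pD a) ?pV //; [lia|auto..].
Qed.

Lemma soluble1 H : is_subgroup H -> (forall x, H x -> x = 1) -> soluble H \/ has_perfect H.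
Proof. by move=> _ h; left; exists 0%N. Qed.

Inductive polyc H : Prop :=
| polyc1 : is_subgroup H -> (forall x, H x -> x = 1) -> polyc H
| polycS K : normal_in K H -> cyclic_factor H K -> polyc K -> polyc H.

Lemma polyc_series H : polyc H -> exists n S, S 0%N = H /\
  [/\ (forall g, S n g <-> g = 1), (forall i, (i < n)%N -> normal_in (S i.+1) (S i)) &
      forall i, (i < n)%N -> cyclic_factor (S i) (S i.+1)].
Proof.
elim=> {H} [H sH H1|H K nK cK _ [n [S [S0 [Sn nS cS]]]]].
  exists 0%N, (fun=> H); split=> //; split=> // g; split=> [/H1//|->]; exact: sub1.
exists n.+1, (fun i => if i is i'.+1 then S i' else H); split=> //.
split=> // -[|i] // hi; rewrite ?S0 //; [exact: nS | exact: cS].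
Qed.

(** Induct on the derived length. The finitely many generators of [H] are adjoined to its derived
    subgroup one at a time; every subgroup of [H] containing the derived subgroup is normal in [H],
    so each step has a cyclic factor. *)
Lemma soluble_polyc H : is_subgroup H -> noetherian H -> soluble H -> polyc H.
Proof.
move=> sH noH [n]; elim: n H sH noH => [|n IH] H sH noH Hn; first exact: polyc1.
have sN := derived_subgroup H; have NH x := @derived_sub H x sH.
have pN : polyc (derived H).
  apply: IH => // [U sU UN|x hx]; first by apply: noH => // x /UN/NH.
  by apply: Hn; rewrite -addn1 dseriesD.
have [l [lH lg]] := noH H sH (fun _ h => h).
have {}lg x : H x -> mgen l x := lg x.
suff [M [pM sM NM MH lM]] : exists M, [/\ polyc M, is_subgroup M,
    (forall x, derived H x -> M x), (forall x, M x -> H x) & forall g, g \in l -> M g].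
  suff -> : H = M by [].
  apply: functional_extensionality => x; apply: propositional_extensionality.
  split=> [/lg|/MH//]; elim=> [|y g _ My /lM Mg]; [exact: sub1|exact: subM].
elim: l lH {lg} => [_|g l IHl lH]; first by exists (derived H).
have [g' gl'|M [pM sM NM MH lM]] := IHl; first by apply: lH; rewrite inE gl' orbT.
have hg : H g by apply: lH; rewrite inE eqxx.
have nM h x : H h -> M x -> M (h^-1 * x * h).
  move=> hh hx; have -> : h^-1 * x * h = x * [~ x, h] by rewrite /commg mulVKg /conjg mulgA.
  by apply: subM => //; apply: NM; apply: derived_comm => //; apply: MH.
pose M' x := exists k : int, M (expgz g (- k)%R * x).
have M'H x : M' x -> H x.
  by move=> [k /MH]; apply: subMl => //; apply: subXz.
have MM' x : M x -> M' x by exists 0%R; rewrite oppr0 mul1g.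
have M'g : M' g by exists 1%R; rewrite /= mulVg; apply: sub1.
have sM' : is_subgroup M'.
  split=> [|x y [k hk] [k' hk']|x [k hk]]; first by apply: MM'; apply: sub1.
    exists (k + k')%R.
    have := subM sM (nM (expgz g k') _ (subXz sH _ hg) hk) hk'.
    rewrite opprD [(- k - _)%R]addrC expgzD !expgzN -!mulgA.
    by rewrite (mulgA (expgz g k')) mulgV mul1g.
  exists (- k)%R; have := nM (expgz g (- k)%R) _ (subXz sH _ hg) (subV sM hk).
  by rewrite invgM !expgzN !invgK !mulgA mulgK.
exists M'; split=> //.
- apply: (polycS _ _ pM).
    by split=> // h x /M'H hh hx; apply: nM.
  exists g => // y [[k|k] hk]; [exists k; left|exists k.+1; right].
    by move: hk; rewrite expgzN.
  by move: hk; rewrite NegzE opprK.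
- by move=> x /NM/MM'.
- by move=> x; rewrite inE => /orP[/eqP->//|/lM/MM'].
Qed.

(** The properties climb the series together, because the infinite cyclic step of residual
    finiteness uses that [K] is finitely generated. *)
Lemma polycyclic_by_finiteP : polycyclic_by_finite G ->
  [/\ noetherian (fun _ : G => True), residually_finite (fun _ : G => True) &
   polycyclic G \/ has_perfect (fun _ : G => True)].
Proof.
move=> pG; pose P H := [/\ is_subgroup H, noetherian H, residually_finite H &
  soluble H \/ has_perfect H].
have [||H [HT]] := series_ind (P := P) _ _ pG.
- move=> H sH H1; split=> //; [exact: noetherian1|exact: residually_finite1|exact: soluble1].
- move=> H K nK fK [sK noK rK solK]; split; first by case: nK.
  + case: fK => fK; [exact: (noetherian_finite nK)|exact: (noetherian_cyclic nK)].
  + case: fK => fK; first exact: (residually_finite_finite nK).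
    by apply: (residually_finite_cyclic nK fK) => //; apply: noK.
  + by case: fK => fK; [apply: (soluble_finite nK)|apply: (soluble_cyclic nK)].
have -> : H = (fun _ : G => True).
  by apply: functional_extensionality => x; apply: propositional_extensionality.
move=> [sT noT rT solT]; split=> //; case: solT => [sol|]; [left|by right].
have [n [S [S0 [Sn nS cS]]]] := polyc_series (soluble_polyc sT noT sol).
by exists n, S; split=> //; split=> // g; rewrite S0.
Qed.

End Solvable.

(** * Integral idempotents over finite groups *)

(** A full rank factorisation [M = C R] of an idempotent satisfies [R C = 1], and this identity
    matrix has the rank as its size. *)
Lemma mxtrace_idempotent (F : fieldType) n (M : 'M[F]_n) :
  (M *m M = M -> \tr M = (\rank M)%:R)%R.
Proof.
move=> MM; have := MM; rewrite -{1 2 3}(mulmx_base M) => h.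
have : (row_base M *m col_base M = 1%:M)%R.
  have /row_freeP[B hB] := row_base_free M.
  have /row_fullP[C hC] : row_full (col_base M) by rewrite col_base_full.
  move: (row_base M) (col_base M) B C hB hC h => R L B C hB hC h.
  have := congr1 (fun X => C *m X *m B)%R h.
  by rewrite !mulmxA hC mul1mx -!mulmxA hB mulmx1.
move=> RL; have <- : (\tr (row_base M *m col_base M) = \tr M)%R.
  by rewrite mxtrace_mulC mulmx_base.
by rewrite RL mxtrace1.
Qed.

Section OrbitSum.
Local Open Scope group_scope.

(** Orbits have [p]-power length, those inside [P] are longer than [p ^ m], and [F] is constant on
    each. *)
Lemma dvd_orbit_sum (T : finType) (s : {perm T}) (P : pred T) (F : T -> int)
    (p k m : nat) : prime p -> s ^+ (p ^ k) = 1 ->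
  (forall x, P (s x) = P x) -> (forall x, F (s x) = F x) ->
  (forall x, P x -> (s ^+ (p ^ m)) x != x) ->
  ((p ^ m.+1)%N%:Z %| (\sum_(x | P x) F x)%R)%Z.
Proof.
move=> pp sk Ps Fs hm.
have Pi x i : P ((s ^+ i) x) = P x.
  by elim: i => [|i IH]; rewrite ?expg0 ?perm1 // expgSr permM Ps.
have Fi x i : F ((s ^+ i) x) = F x.
  by elim: i => [|i IH]; rewrite ?expg0 ?perm1 // expgSr permM Fs.
rewrite (partition_big (porbit s) predT) //=.
apply: rpred_sum => O _.
case: (pickP (fun x => P x && (porbit s x == O))) => [x /andP[Px /eqP xO]|e]; last first.
  by rewrite big_pred0 ?rpred0.
have memO y : (P y && (porbit s y == O)) = (y \in O).
  rewrite -xO eq_porbit_mem; case yx: (y \in porbit s x); last by rewrite andbF.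
  by case/porbitP: yx => i ->; rewrite Pi Px.
rewrite (eq_bigl _ _ memO) (eq_bigr (fun=> F x)); last first.
  by move=> y; rewrite -xO => /porbitP[i ->].
rewrite sumr_const -mulr_natl natz; apply: dvdz_mulr; rewrite dvdzE /=.
have : (#|O| %| p ^ k)%N.
  have so : #[s] %| p ^ k by rewrite order_dvdn sk.
  by apply: dvdn_trans so; rewrite -xO porbit.unlock orderE; exact: (dvdn_orbit 'P <[s]>%G x).
case/(dvdn_pfactor _ _ pp) => j _ jO; rewrite jO.
apply: dvdn_exp2l; rewrite ltnNge; apply/negP => jm.
have /negP[] := hm x Px; apply/eqP.
have sx : (s ^+ (p ^ j)) x = x by rewrite -jO -xO permX iter_porbit.
rewrite -(subnK jm) expnD mulnC expgM.
elim: (p ^ (m - j))%N => [|i IH]; first by rewrite expg0 perm1.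
by rewrite expgS permM sx.
Qed.

End OrbitSum.

Section FiniteSwan.
Variables (gT : finGroupType) (n : nat) (A : gT -> 'M[int]_n).
Local Open Scope group_scope.

Definition wmx (w : seq gT) : 'M[int]_n := foldr (fun g M => A g *m M)%R 1%:M%R w.
Definition wprod (w : seq gT) : gT := foldr mulg 1 w.

Lemma wprod_cat u v : wprod (u ++ v) = wprod u * wprod v.
Proof. by elim: u => [|g u IH]; rewrite ?mul1g //= IH mulgA. Qed.

Lemma wmx_cat u v : wmx (u ++ v) = (wmx u *m wmx v)%R.
Proof. by elim: u => [|g u IH]; rewrite ?mul1mx //= IH mulmxA. Qed.

(** Commuting words: [u] can be cut off the front of [v] again and again, so [v] is [u] repeated [c]
    times. *)
Lemma wprod_periodic m c u v : size u = m -> size v = (m * c)%N -> v ++ u = u ++ v ->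
  wprod v = wprod u ^+ c.
Proof.
move=> um; elim: c v => [|c IH] v vs e.
  by move: vs; rewrite muln0 => /size0nil->; rewrite expg0.
have : take m v = u.
  have := congr1 (take m) e; rewrite takel_cat ?vs ?mulnS ?leq_addr // => ->.
  by rewrite -um take_size_cat.
move=> tv; rewrite -(cat_take_drop m v) tv in e *.
have e' : drop m v ++ u = u ++ drop m v.
  by move/eqP: e; rewrite -catA eqseq_cat // eqxx => /eqP.
by rewrite wprod_cat expgS (IH _ _ e') // size_drop vs mulnS addKn.
Qed.

Hypothesis idem : forall k, A k = (\sum_g A (k * g^-1)%g *m A g)%R.

(** This is the coefficient of [k] in e = e^(q+1), where e = sum_g A_g g is idempotent by [idem]. *)
Lemma idem_words q k : A k = (\sum_(w : q.+1.-tuple gT | wprod w == k) wmx w)%R.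
Proof.
elim: q k => [|q IH] k.
  rewrite (reindex_onto (fun g : gT => [tuple g]) (fun w => thead w)) /=; last first.
    by move=> w _; case/tupleP: w => g w; apply: val_inj; rewrite /= tuple0 /= theadE.
  rewrite (big_pred1 k) /= ?mulmx1 // => g.
  by rewrite mulg1 theadE eqxx andbT.
rewrite idem (reindex (fun h => h^-1 * k)) /=; last first.
  by exists (fun g => k * g^-1) => g _; rewrite ?invMg ?invgK ?mulgA ?mulgV
      ?mul1g ?mulgKV ?mulgK ?mulVg.
under eq_bigr => h _ do rewrite invMg invgK mulKVg (IH (h^-1 * k)) mulmx_sumr.
rewrite pair_big_dep /=.
rewrite (reindex (fun w : q.+2.-tuple gT => (thead w, behead_tuple w))) /=; last first.
  exists (fun p => cons_tuple p.1 p.2) => [w _|[h w] _].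
    by case/tupleP: w => g w; apply: val_inj.
  by congr (_, _); apply: val_inj.
apply: eq_big => w; case/tupleP: w => g w /=; first by rewrite theadE -(can_eq (mulKg g)) mulKVg.
by rewrite theadE.
Qed.

Lemma rot_tuple_inj q : injective (fun w : q.-tuple gT => rot_tuple 1 w).
Proof. by move=> u v /(congr1 val) /= /rot_inj /val_inj. Qed.

Definition rotp q : {perm q.-tuple gT} := perm (@rot_tuple_inj q).

Lemma rotpX q i (w : q.-tuple gT) : (i <= q)%N -> val ((rotp q ^+ i) w) = rot i w.
Proof.
elim: i => [|i IH] lt; first by rewrite expg0 perm1 rot0.
by rewrite expgSr permM permE /= IH ?(ltnW lt) // -rotS ?size_tuple.
Qed.

Lemma trace_rot w : (\tr (wmx (rot 1 w)) = \tr (wmx w))%R.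
Proof. by case: w => [|g w] //; rewrite rot1_cons -cats1 wmx_cat mxtrace_mulC /= mulmx1. Qed.

Lemma wprod_rot g w : wprod (rot 1 (g :: w)) = wprod (g :: w) ^ g.
Proof. by rewrite rot1_cons -cats1 wprod_cat /= mulg1 conjgE !mulgA mulVg mul1g. Qed.

(* A p-singular element is not a p^N-th power when p^N exceeds the group order,
   hence no word with p-singular product and length p^k has period p^(k - N),
   and the rotation orbits of such words have length divisible by p^(k - N + 1). *)
Lemma trace_sum_singular (X : pred gT) p : prime p ->
  (forall g h, X (g ^ h) = X g) -> (forall g, X g -> p %| #[g]) ->
  (\sum_(g | X g) \tr (A g) = 0)%R.
Proof.
move=> pp Xc Xp; set S := (\sum_(g | X g) _)%R; have p1 := prime_gt1 pp.
suff dS m : ((p ^ m.+1)%N%:Z %| S)%Z.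
  apply/eqP; apply: contraT => S0; have := dS `|S|%N; rewrite dvdzE /=.
  move/dvdn_leq; rewrite absz_gt0 S0 => /(_ isT).
  have := ltn_expl `|S|.+1 p1; lia.
pose N := #|gT|; pose k := (m + N)%N; pose q := (p ^ k)%N.
have q0 : (0 < q)%N by rewrite expn_gt0 prime_gt0.
have -> : S = (\sum_(w : q.-tuple gT | X (wprod w)) \tr (wmx w))%R.
  rewrite /S -(prednK q0) [RHS](partition_big (fun w : q.-1.+1.-tuple gT => wprod w) X) //=.
  apply: eq_bigr => g Xg; rewrite (idem_words q.-1 g) raddf_sum.
  by apply: eq_bigl => w; case: eqP => [->|]; rewrite ?Xg ?andbF.
apply: (dvd_orbit_sum (s := rotp q) (k := k) pp) => [||w|w Xw].
- apply/permP => w; apply: val_inj; rewrite rotpX // perm1 -[X in rot X](size_tuple w).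
  exact: rot_size.
- by move=> w; rewrite permE /=; case: (tval w) => [|g v] //; rewrite wprod_rot Xc.
- by rewrite permE /= trace_rot.
apply/negP => /eqP /(congr1 val); rewrite rotpX; last first.
  by rewrite leq_exp2l // leq_addr.
move=> /= rw; have sw := size_tuple w.
have mq : (p ^ m <= size w)%N by rewrite sw leq_exp2l // leq_addr.
have e : wprod w = wprod (take (p ^ m) w) ^+ (p ^ N).
  apply: (wprod_periodic (m := (p ^ m)%N)).
  - by rewrite size_takel.
  - by rewrite sw /q /k expnD.
  - rewrite -{1}(cat_take_drop (p ^ m) w) -catA; congr (_ ++ _).
    exact: rw.
have := Xp _ Xw; rewrite e; set u := wprod _.
have ou : (0 < #[u])%N := order_gt0 u.
(* As [N] is the group order, [p ^ N] is a multiple of the [p]-part of the order of [u]. *)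
have : #[u ^+ (p ^ N)] %| #[u]`_p^'.
  rewrite order_dvdn -expgM -order_dvdn -{1}(partnC p ou) dvdn_mul //.
  rewrite p_part dvdn_exp2l //.
  have : (p ^ logn p #[u] <= #|gT|)%N.
    rewrite -p_part; apply: (@leq_trans #[u]); first by rewrite dvdn_leq // dvdn_part.
    by rewrite orderE -cardsT; apply/subset_leq_card/subsetT.
  have := ltn_expl (logn p #[u]) p1; rewrite /N; lia.
move=> d1 d2; have := dvdn_trans d2 d1.
by apply/negP; rewrite -p'natE // part_pnat.
Qed.

(** The nontrivial elements are sorted by the least prime divisor of their order; each class is
    closed under conjugation, so [trace_sum_singular] applies to it. *)
Lemma trace1_eq0 : (\sum_g A g = 0 -> \tr (A 1%g) = 0)%R.
Proof.
move=> A0; have := congr1 mxtrace A0; rewrite raddf_sum raddf0 /= (bigD1 (1%g : gT)) //=.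
suff -> : (\sum_(g : gT | g != 1%g) \tr (A g) = 0)%R by rewrite addr0.
pose f (g : gT) : 'I_#|gT|.+1 := inord (pdiv #[g]).
have fE g : f g = pdiv #[g] :> nat.
  rewrite inordK // ltnS; apply: leq_trans (pdiv_leq (order_gt0 g)) _.
  by rewrite orderE -cardsT; apply/subset_leq_card/subsetT.
rewrite (partition_big f predT) //= big1 // => j _.
case: (boolP (prime j)) => jp.
  apply: (trace_sum_singular jp) => [g h|g /andP[_ /eqP<-]].
    have -> : f (g ^ h) = f g by apply: val_inj; rewrite /= !fE orderJ.
    by rewrite conjg_eq1.
  by rewrite fE pdiv_dvd.
rewrite big_pred0 // => g; apply/negP => /andP[g1 /eqP gj]; case/negP: jp.
by rewrite -gj fE pdiv_prime // ltn_neqAle eq_sym order_gt0 order_eq1 g1.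
Qed.

(** [M] is the rational matrix of left multiplication by the idempotent on the free module of rank
    [n]. Its trace is the group order times the trace of [A 1], hence zero, and so is its rank. *)
Theorem swan_finite : (\sum_g A g = 0 -> forall g, A g = 0)%R.
Proof.
move/trace1_eq0 => tr0.
pose I : finType := (gT * 'I_n)%type.
pose M : 'M[rat]_#|I| := (\matrix_(i, j) (let p := enum_val i in let q := enum_val j in
  (A (p.1 * q.1^-1)%g p.2 q.2)%:~R))%R.
have trM : (\tr M = 0)%R.
  rewrite /mxtrace (reindex (@enum_rank I)) /=; last first.
    by exists enum_val => x _; rewrite ?enum_rankK ?enum_valK.
  under eq_bigr => p _ do rewrite mxE /= enum_rankK mulgV.
  rewrite -(pair_bigA _ (fun g a => (A 1%g a a)%:~R)%R) /= big1 // => g _.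
  by rewrite -rmorph_sum -/(mxtrace _) tr0.
have MM : (M *m M = M)%R.
  apply/matrixP => i l; rewrite !mxE /= [in RHS]idem summxE rmorph_sum /=.
  rewrite (reindex (@enum_rank I)) /=; last first.
    by exists enum_val => x _; rewrite ?enum_rankK ?enum_valK.
  rewrite [RHS](reindex (fun h => h * (enum_val l).1^-1)) /=; last first.
    by exists (fun h => h * (enum_val l).1) => h _; rewrite ?mulgK ?mulgKV.
  under [RHS]eq_bigr => h _ do rewrite invMg invgK mulgA mulgKV mxE rmorph_sum /=.
  rewrite pair_bigA; apply: eq_bigr => p _.
  by rewrite !mxE enum_rankK rmorphM.
have M0 : M = 0%R.
  apply/eqP; rewrite -mxrank_eq0; have := mxtrace_idempotent MM; rewrite trM => /eqP.
  by rewrite eq_sym pnatr_eq0.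
move=> g; apply/matrixP => a b.
have := congr1 (fun X : 'M_#|I| => X (enum_rank (g, a)) (enum_rank (1, b))) M0.
by rewrite !mxE !enum_rankK /= invg1 mulg1 => /eqP; rewrite intr_eq0 => /eqP.
Qed.

End FiniteSwan.

Lemma eq_big_support (I : eqType) (V : zmodType) (s t : seq I) (f : I -> V) :
  uniq s -> uniq t -> (forall x, f x != 0%R -> x \in s) -> (forall x, f x != 0%R -> x \in t) ->
  (\sum_(x <- s) f x = \sum_(x <- t) f x)%R.
Proof.
move=> us ut fs ft.
have red (r : seq I) : (\sum_(x <- r) f x = \sum_(x <- [seq x <- r | f x != 0%R]) f x)%R.
  by rewrite big_filter [RHS]big_rmcond // => x; rewrite negbK => /eqP.
rewrite red [RHS]red; apply/perm_big/uniq_perm; rewrite ?filter_uniq // => x.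
rewrite !mem_filter; case: (boolP (f x != 0%R)) => //= h.
by rewrite fs ?ft.
Qed.

(** * Integral idempotents over residually finite groups *)

Section ResiduallyFiniteSwan.
Variable G : groupType.
Local Open Scope group_scope.

Let TT (_ : G) := True.

Lemma residually_finite_seq (l : seq G) : residually_finite TT -> (forall x, x \in l -> x <> 1) ->
  exists (T : finType) (c : G -> T), right_congruence TT c /\ forall x, x \in l -> c x <> c 1.
Proof.
move=> rf; elim: l => [_|x l IH hl].
  by exists unit, (fun=> tt); split.
have [|T [c [cR hc]]] := IH; first by move=> y yl; apply: hl; rewrite inE yl orbT.
have [|T' [c' [cR' hc']]] := rf x I; first by apply: hl; rewrite inE eqxx.
exists (T * T')%type, (fun y => (c y, c' y)); split.
  by move=> y z g _ _ _ [e e']; rewrite (cR y z g) // (cR' y z g).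
by move=> y; rewrite inE => /orP[/eqP->|/hc h] [e e'].
Qed.

(** Right multiplication permutes the attained classes; labels outside the range of [c] are fixed,
    which gives permutations of all of [T]. *)
Lemma right_congruence_perm (T : finType) (c : G -> T) : right_congruence TT c ->
  exists rho : G -> {perm T}, (forall g h, rho (g * h) = rho g * rho h) /\
    forall x, rho x (c 1) = c x.
Proof.
move=> cR; pose act g t : T :=
  if asb (exists x, c x = t) then c (epsilon (inhabits 1) (fun x => c x = t) * g) else t.
have actc g x : act g (c x) = c (x * g).
  rewrite /act; case: asbP => [h|[]]; last by exists x.
  by apply: cR => //; apply: (epsilon_spec (inhabits 1) (fun y => c y = c x)).
have actM g h t : act h (act g t) = act (g * h) t.
  have [[x <-]|nx] := classic (exists x, c x = t); first by rewrite !actc mulgA.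
  by rewrite /act; case: (asbP (exists x, c x = t)) => // _; case: asbP.
have act1 t : act 1 t = t.
  have [[x <-]|nx] := classic (exists x, c x = t); first by rewrite actc mulg1.
  by rewrite /act; case: asbP.
have inj g : injective (act g).
  by apply: (can_inj (g := act g^-1)) => t; rewrite actM mulgV act1.
exists (fun g => perm (inj g)); split=> [g h|x].
  by apply/permP => t; rewrite permM !permE actM.
by rewrite permE actc mul1g.
Qed.

Lemma residually_finite_perm (l : seq G) : residually_finite TT -> (forall x, x \in l -> x <> 1) ->
  exists (gT : finGroupType) (rho : G -> gT), (forall g h, rho (g * h) = rho g * rho h) /\
    forall x, x \in l -> rho x <> 1.
Proof.
move=> rf hl; have [T [c [cR hc]]] := residually_finite_seq rf hl.
have [rho [rM r1]] := right_congruence_perm cR.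
exists {perm T}, rho; split=> // x /hc cx e; apply: cx.
by rewrite -r1 e perm1.
Qed.

(* Push the idempotent forward to a finite quotient that separates its support. *)
Theorem swan_residually_finite n (A : G -> 'M[int]_n) (s : seq G) : residually_finite TT ->
  uniq s -> (forall g, A g != 0%R -> g \in s) ->
  (forall k, A k = \sum_(g <- s) A (k * g^-1)%g *m A g)%R ->
  (\sum_(g <- s) A g = 0)%R -> forall g, A g = 0%R.
Proof.
move=> rf us As idem A0.
(* Keeping these quotients away from 1 makes [rho] injective on [s]. *)
pose l := [seq z <- [seq (x * y^-1) | x <- s, y <- s] | z != 1].
have [|gT [rho [rM rl]]] := residually_finite_perm (l := l) rf.
  by move=> x; rewrite mem_filter => /andP[/eqP].
have r1 : rho 1 = 1 by apply: (mulgI (rho 1)); rewrite -rM !mulg1.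
have rV g : rho g^-1 = (rho g)^-1 by apply/esym/mulg1_eq; rewrite -rM mulgV.
have rinj x y : x \in s -> y \in s -> rho x = rho y -> x = y.
  move=> xs ys e; apply/eqP; rewrite -divg_eq1; apply: contraT => xy.
  case: (rl (x * y^-1)); last by rewrite rM rV e mulgV.
  by rewrite mem_filter xy; apply: allpairs_f.
pose B (k : gT) := (\sum_(g <- s | rho g == k) A g)%R.
have BE (r : seq G) k : uniq r -> (forall g, A g != 0%R -> g \in r) ->
    B k = (\sum_(g <- r | rho g == k) A g)%R.
  move=> ur Ar; rewrite /B big_mkcond [RHS]big_mkcond /=.
  by apply: eq_big_support => // g; case: ifP => _; rewrite ?eqxx //; [apply: As|apply: Ar].
(* Both [K] and its right translate by the inverse of any [g] in [s] contain [s], so [BE] applies to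
   each. *)
pose K := undup (s ++ [seq h * g | h <- s, g <- s]).
have idemB k : B k = (\sum_g B (k * g^-1)%g *m B g)%R.
  have -> : (\sum_g B (k * g^-1)%g *m B g = \sum_(g <- s) B (k * (rho g)^-1)%g *m A g)%R.
    rewrite [RHS](partition_big rho predT) //=; apply: eq_bigr => g _.
    by rewrite [B g]/B mulmx_sumr; apply: eq_bigr => h /eqP->.
  rewrite (BE K); last 2 first.
  - exact: undup_uniq.
  - by move=> g /As gs; rewrite mem_undup mem_cat gs.
  under eq_bigr => h _ do rewrite idem.
  rewrite exchange_big /= [LHS]big_seq [RHS]big_seq; apply: eq_bigr => g gs.
  rewrite -mulmx_suml; congr (_ *m _)%R.
  rewrite (BE [seq h * g^-1 | h <- K]); last 2 first.
  - by rewrite map_inj_uniq ?undup_uniq //; apply: mulIg.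
  - move=> h /As hs; apply/mapP; exists (h * g); last by rewrite mulgK.
    by rewrite mem_undup mem_cat (allpairs_f _ hs gs) orbT.
  rewrite big_map; apply: eq_bigl => h.
  by rewrite rM rV (inj_eq (mulIg _)).
have B0 : (\sum_k B k = 0)%R.
  by rewrite -[RHS]A0 [RHS](partition_big rho predT).
move=> g; apply/eqP; apply: contraT => Ag; have gs := As _ Ag.
have := swan_finite idemB B0 (rho g); rewrite /B big_mkcond (bigD1_seq g) //= eqxx.
rewrite big_seq_cond big1; first by rewrite addr0 => /eqP; rewrite (negPf Ag).
move=> h /andP[hs hg]; case: eqP => // e; case/eqP: hg; exact: rinj.
Qed.

End ResiduallyFiniteSwan.

(** * Free right modules and finitely generated summands *)

Section RightModules.
Variable G : groupType.
Local Open Scope ring_scope.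

Section Action.
Variable M : rgmod G.
Implicit Types (m n : M) (g : G).

Lemma ract0 g : ract (0 : M) g = 0.
Proof. by apply: (addrI (ract 0 g)); rewrite -ractD !addr0. Qed.

Lemma ractN m g : ract (- m) g = - ract m g.
Proof. by apply: (addrI (ract m g)); rewrite -ractD !subrr ract0. Qed.

Lemma ract_sum (I : Type) (r : seq I) (P : pred I) (f : I -> M) g :
  ract (\sum_(i <- r | P i) f i) g = \sum_(i <- r | P i) ract (f i) g.
Proof. exact: (big_morph (fun m => ract m g) (fun x y => ractD g x y) (ract0 g)). Qed.

Lemma ractMz m g (c : int) : ract (m *~ c) g = ract m g *~ c.
Proof.
have nat (k : nat) : ract (m *+ k) g = ract m g *+ k.
  by elim: k => [|k IH]; rewrite ?ract0 // !mulrS ractD IH.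
by case: c => k; rewrite ?NegzE ?mulrNz ?ractN -!pmulrn nat.
Qed.

End Action.

Section Hom.
Variables (M N : rgmod G) (f : M -> N) (hf : ghom f).

Lemma ghomD x y : f (x + y) = f x + f y. Proof. exact: hf.1. Qed.
Lemma ghom_act x g : f (ract x g) = ract (f x) g. Proof. exact: hf.2. Qed.
Lemma ghom0 : f 0 = 0. Proof. by apply: (addrI (f 0)); rewrite -ghomD !addr0. Qed.
Lemma ghomN x : f (- x) = - f x.
Proof. by apply: (addrI (f x)); rewrite -ghomD !subrr ghom0. Qed.
Lemma ghomB x y : f (x - y) = f x - f y. Proof. by rewrite ghomD ghomN. Qed.
Lemma ghom_sum (I : Type) (r : seq I) (P : pred I) (u : I -> M) :
  f (\sum_(i <- r | P i) u i) = \sum_(i <- r | P i) f (u i).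
Proof. exact: (big_morph f ghomD ghom0). Qed.
Lemma ghomMz x (c : int) : f (x *~ c) = f x *~ c.
Proof.
have nat (k : nat) : f (x *+ k) = f x *+ k.
  by elim: k => [|k IH]; rewrite ?ghom0 // !mulrS ghomD IH.
by case: c => k; rewrite ?NegzE ?mulrNz ?ghomN -!pmulrn nat.
Qed.

End Hom.

Lemma ghom_id (M : rgmod G) : ghom (fun x : M => x). Proof. by []. Qed.

Lemma ghom_comp (M N K : rgmod G) (f : N -> K) (g : M -> N) :
  ghom f -> ghom g -> ghom (fun x => f (g x)).
Proof. by move=> [fD fa] [gD ga]; split=> *; rewrite ?gD ?ga ?fD ?fa. Qed.

Lemma ghom_add (M N : rgmod G) (f g : M -> N) :
  ghom f -> ghom g -> ghom (fun x => f x + g x).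
Proof. by move=> [fD fa] [gD ga]; split=> *; rewrite ?fD ?gD ?fa ?ga ?ractD // addrACA. Qed.

Lemma ghom_opp (M N : rgmod G) (f : M -> N) : ghom f -> ghom (fun x => - f x).
Proof. by move=> [fD fa]; split=> *; rewrite ?fD ?fa ?ractN // opprD. Qed.

Definition trivial_int : rgmod G :=
  @RGMod G int (fun m _ => m) (fun _ => erefl) (fun _ _ _ => erefl) (fun _ _ _ => erefl).

Section FreeModule.
Variable X : choiceType.
Local Notation F0 := {malg int[(X * G)%type]}.

(** The free module on [X] consists of the finitely supported integer functions on [X * G], where
    [(x, g)] stands for the basis element [x] acted on by [g]. *)
Definition fract (f : F0) (g : G) : F0 :=
  \sum_(k <- msupp f) << f@_k *g (k.1, (k.2 * g)%g) >>.

Lemma fractE f g x h : (fract f g)@_(x, h) = f@_(x, (h * g^-1)%g).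
Proof.
rewrite /fract raddf_sum /=.
have eqk (k : X * G) : ((k.1, (k.2 * g)%g) == (x, h)) = (k == (x, (h * g^-1)%g)).
  rewrite -!pair_eqE /= /pair_eq /=; congr (_ && _).
  by apply/eqP/eqP => [<-|->]; rewrite ?mulgK ?mulgKV.
under eq_bigr => k _ do rewrite mcoeffU eqk.
have [hx|hx] := msuppP; last first.
  rewrite big1_seq // => k /andP[_ ks]; case: eqP => // e; by rewrite -e ks in hx.
rewrite (bigD1_seq _ hx) ?fset_uniq //= eqxx mulr1n big1 ?addr0 // => k /negPf->.
by rewrite mulr0n.
Qed.

Lemma fract1 f : fract f 1%g = f.
Proof. by apply/malgP => -[x h]; rewrite fractE invg1 mulg1. Qed.
Lemma fractM f g h : fract f (g * h)%g = fract (fract f g) h.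
Proof. by apply/malgP => -[x k]; rewrite !fractE invgM mulgA. Qed.
Lemma fractD g f1 f2 : fract (f1 + f2) g = fract f1 g + fract f2 g.
Proof. by apply/malgP => -[x k]; rewrite !(fractE, mcoeffD). Qed.

Definition free_rgmod : rgmod G := RGMod fract1 fractM fractD.

Definition fbasis (x : X) : free_rgmod := << 1 *g (x, 1%g) >>.

Lemma fbasisE (c : int) x g : << c *g (x, g) >> = ract (fbasis x) g *~ c :> free_rgmod.
Proof.
apply/malgP => -[y h]; rewrite raddfMz /= fractE !mcoeffU -!pair_eqE /= /pair_eq /=.
have -> : (1%g == (h * g^-1)%g) = (g == h).
  by apply/eqP/eqP => [e|->]; [apply/esym/divg1_eq; rewrite -e|rewrite mulgV].
by case: (_ && _); rewrite ?mulr0n ?mul0rz // !mulr1n intz.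
Qed.

Lemma free_sumw (f : free_rgmod) (D : seq (X * G)) : uniq D ->
  (forall k, f@_k != 0 -> k \in D) ->
  f = \sum_(k <- D) ract (fbasis k.1) k.2 *~ f@_k.
Proof.
move=> uD hD; rewrite {1}[f]monalgE.
under [RHS]eq_bigr => k _ do rewrite -fbasisE -surjective_pairing.
apply: eq_big_support; rewrite ?fset_uniq // => k.
  by apply: contraNT => h; rewrite mcoeff_outdom // monalgU0.
move=> h; apply: hD; apply: contraNneq h => ->; by rewrite monalgU0.
Qed.

Lemma free_sum (f : free_rgmod) :
  f = \sum_(k <- msupp f) ract (fbasis k.1) k.2 *~ f@_k.
Proof. by apply: free_sumw => [|k]; rewrite ?fset_uniq // mcoeff_neq0. Qed.

Section Lift.
Variables (M : rgmod G) (phi : X -> M).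

Definition flift (f : free_rgmod) : M :=
  \sum_(k <- msupp f) ract (phi k.1) k.2 *~ f@_k.

(** Allowing any list that contains the support lets elements with different supports be added over
    one list. *)
Lemma fliftw (f : free_rgmod) (D : seq (X * G)) : uniq D ->
  (forall k, f@_k != 0 -> k \in D) ->
  flift f = \sum_(k <- D) ract (phi k.1) k.2 *~ f@_k.
Proof.
move=> uD hD; apply: eq_big_support; rewrite ?fset_uniq // => k.
  by apply: contraNT => h; rewrite mcoeff_outdom // mulr0z.
by move=> h; apply: hD; apply: contraNneq h => ->; rewrite mulr0z.
Qed.

Lemma flift_basis x : flift (fbasis x) = phi x.
Proof.
rewrite (@fliftw _ [:: (x, 1%g)]) // => [|k].
  by rewrite big_seq1 /= ract1 mcoeffUU.
by apply: contraR; rewrite inE mcoeffU eq_sym => /negPf->.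
Qed.

Lemma flift_ghom : ghom flift.
Proof.
split=> [f1 f2|f g].
  pose D := undup (msupp f1 ++ msupp f2 : seq _); have uD : uniq D := undup_uniq _.
  have D1 k : f1@_k != 0 -> k \in D.
    by rewrite mcoeff_neq0 mem_undup mem_cat => ->.
  have D2 k : f2@_k != 0 -> k \in D.
    by rewrite mcoeff_neq0 mem_undup mem_cat orbC => ->.
  rewrite (fliftw uD D1) (fliftw uD D2) (@fliftw _ D) //.
    by rewrite -big_split; apply: eq_bigr => k _; rewrite mcoeffD mulrzDr.
  move=> k; apply: contraR => kD; rewrite mcoeffD.
  by rewrite (eqP (contraR (D1 k) kD)) (eqP (contraR (D2 k) kD)) addr0.
pose D := [seq (k.1, (k.2 * g)%g) | k <- (msupp f : seq _)].
rewrite (@fliftw _ D); first last.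
- move=> [x h]; rewrite fractE mcoeff_neq0 => hs; apply/mapP.
  by exists (x, (h * g^-1)%g); rewrite //= mulgVK.
- rewrite map_inj_uniq ?fset_uniq // => -[x h] [y h'] [-> /mulIg ->] //.
rewrite big_map ract_sum; apply: eq_bigr => -[x h] _ /=.
by rewrite fractE mulgK ractMz ractM.
Qed.

End Lift.

Lemma free_ghom_ext (M : rgmod G) (f g : free_rgmod -> M) : ghom f -> ghom g ->
  (forall x, f (fbasis x) = g (fbasis x)) -> forall u, f u = g u.
Proof.
move=> hf hg e u; rewrite [u]free_sum (ghom_sum hf) (ghom_sum hg).
by apply: eq_bigr => k _; rewrite (ghomMz hf) (ghomMz hg) (ghom_act hf) (ghom_act hg) e.
Qed.

Lemma free_retract_projective (P : rgmod G) (i : P -> free_rgmod) (pr : free_rgmod -> P) :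
  ghom i -> ghom pr -> (forall x, pr (i x) = x) -> projective P.
Proof.
move=> hi hpr prK A B f g hf fsurj hg.
have ex x : exists a, f a == g (pr (fbasis x)).
  by have [a e] := fsurj (g (pr (fbasis x))); exists a; apply/eqP.
pose h := flift (fun x => xchoose (ex x)).
have hh : ghom h := flift_ghom _.
exists (fun x => h (i x)); split; first exact: ghom_comp.
move=> x; rewrite -[in RHS](prK x).
apply: (free_ghom_ext (ghom_comp hf hh) (ghom_comp hg hpr)) => y.
by rewrite /h flift_basis; apply/eqP/(xchooseP (ex y)).
Qed.

(** The trivial intersection makes the component in [Q] unique, so choosing it yields a
    homomorphism. *)
Lemma summand_projection (P : rgmod G) (Q : P -> Prop) : direct_summand Q ->
  exists e : P -> P, [/\ ghom e, (forall x, Q (e x)) & forall q, Q q -> e q = q].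
Proof.
move=> [[Q0 QD QN Qa] [Q' [[Q0' QD' QN' Qa'] disj dec]]].
pose e x := epsilon (inhabits (0 : P)) (fun a => Q a /\ Q' (x - a)).
have eP x : Q (e x) /\ Q' (x - e x).
  apply: (epsilon_spec (inhabits (0 : P)) (fun a => Q a /\ Q' (x - a))).
  by have [a [b [ha hb ->]]] := dec x; exists a; rewrite addrAC subrr add0r.
have eE x a : Q a -> Q' (x - a) -> e x = a.
  move=> ha hb; have [hc hd] := eP x; apply/eqP; rewrite -subr_eq0; apply/eqP.
  apply: disj; first by apply/QD/QN.
  have -> : e x - a = (x - a) - (x - e x) by rewrite opprB [RHS]addrC addrA subrK.
  by apply/QD'/QN'.
exists e; split=> [|x|q hq]; last 1 first.
- by apply: eE; rewrite ?subrr.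
- split=> [x y|x g]; apply: eE.
  + by apply: QD; apply: (eP _).1.
  + by rewrite opprD addrACA; apply: QD'; apply: (eP _).2.
  + by apply: Qa; apply: (eP _).1.
  + by rewrite -ractN -ractD; apply: Qa'; apply: (eP _).2.
- exact: (eP x).1.
Qed.

(** The idempotent [E] of the free module has image [i Q], supported over a finite set [W] of basis
    elements, so its columns over [W] form an idempotent matrix over the group ring. Its
    augmentation vanishes, and Swan's theorem makes it zero. *)
Theorem fg_summand_eq0 (P : rgmod G) (i : P -> free_rgmod) (pr : free_rgmod -> P)
    (Q : P -> Prop) :
  residually_finite (fun _ : G => True) ->
  ghom i -> ghom pr -> (forall x, pr (i x) = x) ->
  (forall f : P -> trivial_int, ghom f -> forall x, f x = 0) ->
  direct_summand Q -> fg_submodule Q -> forall x, Q x -> x = 0.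
Proof.
move=> rf hi hpr prK triv0 dsQ [_ [l [lQ lgen]]].
have [e [he eQ eid]] := summand_projection dsQ.
pose W := undup (flatten [seq [seq k.1 | k <- (msupp (i q) : seq _)] | q <- l]).
have QW q k : Q q -> (i q)@_k != 0 -> k.1 \in W.
  move=> hq; move: k; pose S q := forall k, (i q)@_k != 0 -> k.1 \in W.
  apply: (lgen S) => // [|p pl k].
    split=> [k|x y Sx Sy k|x Sx k|x g Sx [k h]]; rewrite /S.
    - by rewrite (ghom0 hi) mcoeff0 eqxx.
    - rewrite (ghomD hi) mcoeffD => h; have [e0|/Sx//] := eqVneq (i x)@_k 0.
      by apply: Sy; rewrite e0 add0r in h.
    - by rewrite (ghomN hi) mcoeffN oppr_eq0 => /Sx.
    - by rewrite (ghom_act hi) /= fractE => /Sx.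
  rewrite mcoeff_neq0 => hk; rewrite mem_undup; apply/flattenP.
  by exists [seq k.1 | k <- (msupp (i p) : seq _)]; apply: map_f.
pose E f := i (e (pr f)); have hE : ghom E by do 2!apply: ghom_comp => //.
have EE f : E (E f) = E f by rewrite /E prK eid.
pose n := size W; pose w (j : 'I_n) := tnth (in_tuple W) j.
have winj : injective w by apply/tuple_uniqP; apply: undup_uniq.
have wW x : x \in W -> exists j, w j = x.
  by move=> /(tnthP (in_tuple W)) [j ->]; exists j.
pose s := undup (flatten
  [seq [seq k.2 | k <- (msupp (E (fbasis (w j))) : seq _)] | j <- enum 'I_n]).
pose A g : 'M[int]_n := \matrix_(a, j) (E (fbasis (w j)))@_(w a, g).
have As g : A g != 0 -> g \in s.
  apply: contraR => gs; apply/eqP/matrixP => a j; rewrite !mxE; apply/eqP.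
  apply: contraR gs; rewrite mcoeff_neq0 => h; rewrite mem_undup; apply/flattenP.
  exists [seq k.2 | k <- (msupp (E (fbasis (w j))) : seq _)]; last by apply/mapP; exists (w a, g).
  by apply/mapP; exists j; rewrite ?mem_enum.
have EB j : E (fbasis (w j)) = \sum_a \sum_(g <- s) ract (fbasis (w a)) g *~ A g a j.
  pose D := [seq (w a, g) | a <- enum 'I_n, g <- s].
  rewrite [LHS](@free_sumw _ D); first last.
  - move=> [x g] h; have [a aw] := wW x (QW _ _ (eQ _) h); rewrite -aw.
    apply: allpairs_f; rewrite ?mem_enum // mem_undup; apply/flattenP.
    exists [seq k.2 | k <- (msupp (E (fbasis (w j))) : seq _)].
      by apply/mapP; exists j; rewrite ?mem_enum.
    by apply/mapP; exists (x, g); rewrite // -mcoeff_neq0.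
  - by apply: allpairs_uniq; rewrite ?enum_uniq ?undup_uniq // => -[a g] [b h] _ _ [/winj-> ->].
  rewrite /D big_allpairs_dep big_enum; apply: eq_bigr => a _; apply: eq_bigr => g _.
  by rewrite mxE.
have us : uniq s := undup_uniq _.
have idem k : A k = \sum_(g <- s) A (k * g^-1)%g *m A g.
  apply/matrixP => a j; rewrite mxE -EE {1}EB (ghom_sum hE) raddf_sum summxE /=.
  under eq_bigr => b _ do rewrite (ghom_sum hE) raddf_sum /=.
  rewrite exchange_big; apply: eq_bigr => g _; rewrite mxE; apply: eq_bigr => b _.
  by rewrite (ghomMz hE) (ghom_act hE) raddfMz /= fractE !mxE mulrzz.
have A0 : \sum_(g <- s) A g = 0.
  apply/matrixP => a j; rewrite summxE mxE.
  (* [ep] is the augmentation of the coordinate at [w a]. Composed with [i] and [e] it maps [P] to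
     the integers, hence is zero; its value at the basis element [w j] is the [(a, j)] entry of the
     sum of the [A g]. *)
  pose ep : free_rgmod -> trivial_int := flift (fun x => (x == w a)%:R : trivial_int).
  have hep : ghom ep := flift_ghom _.
  have epB x : ep (fbasis x) = (x == w a)%:R by exact: flift_basis.
  have : ep (E (fbasis (w j))) = 0.
    exact: triv0 _ (ghom_comp hep (ghom_comp hi he)) (pr (fbasis (w j))).
  clearbody ep; rewrite EB (ghom_sum hep) => e0.
  rewrite -[RHS]e0 (bigD1 a) //=.
  rewrite [X in _ = _ + X]big1 => [|b ba].
    rewrite addr0 (ghom_sum hep); apply: eq_bigr => g _.
    by rewrite (ghomMz hep) (ghom_act hep) epB eqxx intz.
  rewrite (ghom_sum hep) big1 // => g _.
  by rewrite (ghomMz hep) (ghom_act hep) epB (inj_eq winj) (negPf ba) mul0rz.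
have AE0 := swan_residually_finite rf us As idem A0.
have E0 j : E (fbasis (w j)) = 0.
  by rewrite EB big1 // => a _; rewrite big1 // => g _; rewrite AE0 mxE mulr0z.
move=> q hq; rewrite -[q]prK -[pr _]prK.
have -> : i (pr (i q)) = E (i q) by rewrite /E prK eid.
rewrite [i q]free_sum (ghom_sum hE) big1_seq ?(ghom0 hpr) // => k /andP[_].
rewrite -mcoeff_neq0 => /(QW _ _ hq) /wW[j jw].
by rewrite (ghomMz hE) (ghom_act hE) -jw E0 ract0 mul0rz.
Qed.

End FreeModule.

(** A basis element could be sent to 1 in [trivial_int]; over an empty basis the identity and the
    zero map agree, so [P] would be zero. *)
Lemma not_free_of_trivial_quotient0 (P : rgmod G) : (exists x : P, x != 0) ->
  (forall f : P -> trivial_int, ghom f -> forall x, f x = 0) -> ~ free_module P.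
Proof.
move=> [x x0] triv0 [B hB]; case: (classic (exists b, B b)) => [[b Bb]|nB].
  have [[h [hh hb]] _] := hB trivial_int (fun _ => 1).
  by have := triv0 h hh b; rewrite hb.
have [_ uni] := hB P (fun x => x).
case/eqP: x0; apply: (uni (fun x => x) (fun=> 0) (ghom_id P)).
- by split=> *; rewrite ?addr0 ?ract0.
- by move=> b Bb; case: nB; exists b.
Qed.

End RightModules.

(** * The ideal generated by the augmentation of a perfect subgroup *)

Section Kernel.
Variables (G : groupType) (M : rgmod G) (r : M -> M) (hr : ghom r).
Local Open Scope ring_scope.

(** The proof is an argument of the predicate so that the closure instance can be inferred from the
    predicate alone. *)
Definition kernel_pred (_ : ghom r) : {pred M} := fun x => r x == 0.

Lemma kernel_zmod_closed : zmod_closed (kernel_pred hr).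
Proof.
split=> [|x y]; rewrite !unfold_in; first by rewrite (ghom0 hr).
by move=> /eqP ex /eqP ey; rewrite (ghomB hr) ex ey subrr.
Qed.

HB.instance Definition _ := GRing.isZmodClosed.Build M (kernel_pred hr) kernel_zmod_closed.

Record kernel := Kernel { kernel_val :> M; kernel_valP : kernel_val \in kernel_pred hr }.

HB.instance Definition _ := [isSub for kernel_val].
HB.instance Definition _ := [Choice of kernel by <:].
HB.instance Definition _ := [SubChoice_isSubZmodule of kernel by <:].

Lemma kernel_act_subproof (x : kernel) g : ract (val x) g \in kernel_pred hr.
Proof. by have := valP x; rewrite !unfold_in (ghom_act hr) => /eqP->; rewrite ract0. Qed.

Definition kernel_act (x : kernel) g : kernel := Kernel (kernel_act_subproof x g).

Lemma kernel_act1 x : kernel_act x 1%g = x.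
Proof. by apply: val_inj; rewrite /= ract1. Qed.
Lemma kernel_actM x g h : kernel_act x (g * h)%g = kernel_act (kernel_act x g) h.
Proof. by apply: val_inj; rewrite /= ractM. Qed.
Lemma kernel_actD g x y : kernel_act (x + y) g = kernel_act x g + kernel_act y g.
Proof. by apply: val_inj; rewrite /= ractD. Qed.

Definition kernel_rgmod : rgmod G := RGMod kernel_act1 kernel_actM kernel_actD.

Definition kernel_incl (x : kernel_rgmod) : M := kernel_val x.

Lemma kernel_incl_ghom : ghom kernel_incl. Proof. by []. Qed.

End Kernel.

Section Augmentation.
Variable G : groupType.
Local Open Scope ring_scope.
Implicit Types (M N : rgmod G) (a : seq (int * G)).

(* A list of pairs (c, g) stands for the element sum c g of ZG, and elements
   of ZG are compared through their action on all right modules. *)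
Definition gract M (m : M) a : M := \sum_(p <- a) ract m p.2 *~ p.1.

(** This is [m (g - 1)]. *)
Definition aug M (m : M) g : M := ract m g - m.

Lemma gract_cat M (m : M) a (b : seq (int * G)) : gract m (a ++ b) = gract m a + gract m b.
Proof. by rewrite /gract big_cat. Qed.

Lemma gractD M (m n : M) a : gract (m + n) a = gract m a + gract n a.
Proof. by rewrite /gract -big_split; apply: eq_bigr => p _; rewrite ractD mulrzDl. Qed.

Lemma gract0 M a : gract (0 : M) a = 0.
Proof. by rewrite /gract big1 // => p _; rewrite ract0 mul0rz. Qed.

Lemma gract_sum M (I : Type) (r : seq I) (P : pred I) (f : I -> M) a :
  gract (\sum_(i <- r | P i) f i) a = \sum_(i <- r | P i) gract (f i) a.
Proof. exact: (big_morph (fun m => gract m a) (fun x y => gractD x y a) (gract0 M a)). Qed.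

Lemma gract1 M (m : M) g : gract m [:: (1, g)] = ract m g.
Proof. by rewrite /gract big_seq1. Qed.

Lemma gract_ghom M N (f : M -> N) (m : M) a : ghom f -> f (gract m a) = gract (f m) a.
Proof.
move=> hf; rewrite (ghom_sum hf); apply: eq_bigr => p _.
by rewrite (ghomMz hf) (ghom_act hf).
Qed.

Lemma aug_ghom M N (f : M -> N) (m : M) g : ghom f -> f (aug m g) = aug (f m) g.
Proof. by move=> hf; rewrite (ghomB hf) (ghom_act hf). Qed.

Lemma aug1 M (m : M) : aug m 1%g = 0. Proof. by rewrite /aug ract1 subrr. Qed.
Lemma augD M (m n : M) g : aug (m + n) g = aug m g + aug n g.
Proof. by rewrite /aug ractD opprD addrACA. Qed.
Lemma augN M (m : M) g : aug (- m) g = - aug m g.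
Proof. by rewrite /aug ractN opprD. Qed.
Lemma aug0 M g : aug (0 : M) g = 0.
Proof. by rewrite /aug ract0 subrr. Qed.
Lemma aug_sum M (I : Type) (r : seq I) (P : pred I) (f : I -> M) g :
  aug (\sum_(i <- r | P i) f i) g = \sum_(i <- r | P i) aug (f i) g.
Proof. exact: (big_morph (fun m => aug m g) (fun x y => augD x y g) (aug0 M g)). Qed.

Lemma aug_mul M (m : M) g h : aug m (g * h)%g = aug (ract m g) h + aug m g.
Proof. by rewrite /aug ractM addrA subrK. Qed.

(** In ZG, [[x, y] - 1 = x^-1 y^-1 ((x - 1)(y - 1) - (y - 1)(x - 1))]. *)
Lemma aug_commutator M (m : M) x y :
  aug m [~ x, y]%g = let m' := ract (ract m x^-1%g) y^-1%g in
    aug (aug m' x) y - aug (aug m' y) x.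
Proof.
rewrite /= /aug /commg /conjg; set m' := ract (ract m _) _.
have -> : ract m (x^-1 * (y^-1 * (x * y)))%g = ract (ract m' x) y by rewrite !ractM.
have e : ract (ract m' y) x = m by rewrite /m' -!ractM !mulgA mulgVK mulVg ract1.
rewrite !ractD !ractN e !opprB addrACA !addrA !subrK //.
Qed.

Section Perfect.
Variables (d : nat) (h : 'I_d -> G).

(* Families of maps m |-> m u with u in the left ideal of ZG generated by the
   h j - 1, respectively by the products (h j - 1)(h i - 1). *)
Definition in_ideal (phi : forall M, M -> M) := exists c : 'I_d -> seq (int * G),
  forall M (m : M), phi M m = \sum_j aug (gract m (c j)) (h j).

Definition in_ideal2 (phi : forall M, M -> M) :=
  exists b : 'I_d -> 'I_d -> seq (int * G),
  forall M (m : M), phi M m = \sum_i \sum_j aug (aug (gract m (b j i)) (h j)) (h i).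

Definition gopp (a : seq (int * G)) := [seq (- p.1, p.2) | p <- a].
Lemma gract_opp M (m : M) a : gract m (gopp a) = - gract m a.
Proof. by rewrite /gract big_map -sumrN; apply: eq_bigr => p _; rewrite mulrNz. Qed.

Definition gmul g (a : seq (int * G)) := [seq (p.1, (g * p.2)%g) | p <- a].
Lemma gract_mul M (m : M) g a : gract m (gmul g a) = gract (ract m g) a.
Proof. by rewrite /gract big_map; apply: eq_bigr => p _; rewrite ractM. Qed.

Lemma in_ideal_ext (phi psi : forall M, M -> M) :
  (forall M (m : M), phi M m = psi M m) -> in_ideal psi -> in_ideal phi.
Proof. by move=> e [c hc]; exists c => M m; rewrite e. Qed.

Lemma in_ideal0 : in_ideal (fun M _ => 0).
Proof. by exists (fun=> [::]) => M m; rewrite big1 // => j _; rewrite /gract big_nil aug0. Qed.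

Lemma in_idealD (phi psi : forall M, M -> M) : in_ideal phi -> in_ideal psi ->
  in_ideal (fun M m => phi M m + psi M m).
Proof.
move=> [c hc] [c' hc']; exists (fun j => c j ++ c' j) => M m.
by rewrite hc hc' -big_split; apply: eq_bigr => j _; rewrite gract_cat augD.
Qed.

Lemma in_idealN (phi : forall M, M -> M) : in_ideal phi -> in_ideal (fun M m => - phi M m).
Proof.
move=> [c hc]; exists (fun j => gopp (c j)) => M m.
by rewrite hc -sumrN; apply: eq_bigr => j _; rewrite gract_opp augN.
Qed.

Lemma in_idealMz (phi : forall M, M -> M) (k : int) :
  in_ideal phi -> in_ideal (fun M m => phi M m *~ k).
Proof.
move=> hp; have nat (n : nat) : in_ideal (fun M m => phi M m *+ n).
  elim: n => [|n IH]; first exact: in_ideal0.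
  by apply: in_ideal_ext (in_idealD hp IH) => M m; rewrite mulrS.
case: k => n; first exact: nat.
by apply: in_ideal_ext (in_idealN (nat n.+1)) => M m; rewrite NegzE mulrNz.
Qed.

Lemma in_ideal2_ext (phi psi : forall M, M -> M) :
  (forall M (m : M), phi M m = psi M m) -> in_ideal2 psi -> in_ideal2 phi.
Proof. by move=> e [c hc]; exists c => M m; rewrite e. Qed.

Lemma in_ideal2D (phi psi : forall M, M -> M) : in_ideal2 phi -> in_ideal2 psi ->
  in_ideal2 (fun M m => phi M m + psi M m).
Proof.
move=> [c hc] [c' hc']; exists (fun j i => c j i ++ c' j i) => M m.
rewrite hc hc' -big_split; apply: eq_bigr => i _; rewrite -big_split; apply: eq_bigr => j _.
by rewrite gract_cat !augD.
Qed.

Lemma in_ideal2N (phi : forall M, M -> M) : in_ideal2 phi -> in_ideal2 (fun M m => - phi M m).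
Proof.
move=> [c hc]; exists (fun j i => gopp (c j i)) => M m.
rewrite hc -sumrN; apply: eq_bigr => i _; rewrite -sumrN; apply: eq_bigr => j _.
by rewrite gract_opp !augN.
Qed.

Lemma in_ideal2_act (phi : forall M, M -> M) g : in_ideal2 phi ->
  in_ideal2 (fun M m => phi M (ract m g)).
Proof.
move=> [c hc]; exists (fun j i => gmul g (c j i)) => M m.
by rewrite hc; apply: eq_bigr => i _; apply: eq_bigr => j _; rewrite gract_mul.
Qed.

Lemma in_ideal2_sum (psi : 'I_d -> forall M, M -> M) : (forall i, in_ideal (psi i)) ->
  in_ideal2 (fun M m => \sum_i aug (psi i M m) (h i)).
Proof.
move=> hp; pose c i := constructive_indefinite_description _ (hp i).
exists (fun j i => proj1_sig (c i) j) => M m; apply: eq_bigr => i _.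
by rewrite (proj2_sig (c i)) aug_sum.
Qed.

(** Induct with [x y - 1 = x (y - 1) + (x - 1)]. The group elements in the coefficients stay in
    [mgen l], so that [aug2_in_ideal2] can expand again. *)
Lemma aug_in_ideal l g : (forall x, x \in l -> exists i, h i = x) ->
  mgen l g -> exists c : 'I_d -> seq (int * G),
    (forall i p, p \in c i -> mgen l p.2) /\
    forall M (m : M), aug m g = \sum_j aug (gract m (c j)) (h j).
Proof.
move=> hl; elim=> [|x y hx [c [cl hc]] /[dup] yl /hl[i hi]].
  exists (fun=> [::]); split=> // M m; rewrite aug1 big1 // => j _.
  by rewrite /gract big_nil aug0.
exists (fun j => c j ++ (if j == i then [:: (1, x)] else [::])); split=> [j p|M m].
  rewrite mem_cat => /orP[/cl//|]; case: ifP => // _; by rewrite inE => /eqP->.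
rewrite aug_mul hc [RHS](bigD1 i) // [in LHS](bigD1 i) //= gract_cat eqxx.
rewrite gract1 augD hi [aug (gract _ _) _ + _]addrC addrA.
congr (_ + _); apply: eq_bigr => j /negPf->; by rewrite cats0.
Qed.

(** Write [g' - 1 = sum_i c_i (h_i - 1)]. Each [(g - 1) c_i] lies in the left ideal because
    [(g - 1) x = (g x - 1) - (x - 1)]. *)
Lemma aug2_in_ideal2 l g g' : (forall x, x \in l -> exists i, h i = x) ->
  mgen l g -> mgen l g' -> in_ideal2 (fun M m => aug (aug m g) g').
Proof.
move=> hl hg /(aug_in_ideal hl)[c [cl hc]].
have id1 x : mgen l x -> in_ideal (fun M m => aug m x).
  by move=> /(aug_in_ideal hl)[c' [_ hc']]; exists c'.
apply: in_ideal2_ext (in_ideal2_sum (psi := fun i M m => gract (aug m g) (c i)) _) => [M m|i].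
  exact: hc.
have : forall p, p \in c i -> mgen l p.2 by apply: cl.
elim: (c i) => [_|p r IH hp].
  by apply: in_ideal_ext in_ideal0 => M m; rewrite /gract big_nil.
have h1 := id1 p.2 (hp p (mem_head _ _)).
have h2 := id1 _ (mgen_mul hg (hp p (mem_head _ _))).
have h3 := IH (fun q hq => hp q (mem_behead (s := p :: r) hq)).
apply: in_ideal_ext (in_idealD (in_idealMz p.1 (in_idealD h2 (in_idealN h1))) h3) => M m.
rewrite /gract big_cons; congr (_ *~ _ + _).
by rewrite aug_mul /aug ractD ractN opprB !addrA !subrK.
Qed.

(** By [aug_commutator], [[a, b] - 1] is a left multiple of a difference of products of two
    augmentations, and the left factors are absorbed by [in_ideal2_act]. *)
Lemma aug_perfect l U : (forall x, x \in l -> exists i, h i = x) ->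
  (forall x, U x -> mgen l x) -> forall g, derived U g -> in_ideal2 (fun M m => aug m g).
Proof.
move=> hl Ul g; elim=> [|y a b _ IH /Ul ha /Ul hb].
  exists (fun _ _ => [::]) => M m; rewrite aug1 big1 // => i _.
  by rewrite big1 // => j _; rewrite /gract big_nil !aug0.
have ab := aug2_in_ideal2 hl ha hb; have ba := aug2_in_ideal2 hl hb ha.
have := in_ideal2D (in_ideal2_act y (in_ideal2_act a^-1 (in_ideal2_act b^-1
  (in_ideal2D ab (in_ideal2N ba))))) IH.
by apply: in_ideal2_ext => M m; rewrite aug_mul aug_commutator.
Qed.

End Perfect.

End Augmentation.

(** * Splitting the map 1 - A *)

Section Telescope.
Variables (G : groupType) (F : rgmod G) (A B S : F -> F).
Local Open Scope ring_scope.
Implicit Types f : F.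
Hypotheses (hA : ghom A) (hB : ghom B) (hS : ghom S).
Hypothesis BAA : forall f, B (A (A f)) = A f.
Hypothesis S_rec : forall f, S f = f + S (B f).

(* retr is a left inverse of 1 - A, so 1 - (1 - A) retr projects F onto the
   kernel of retr, a copy of F / (1 - A) F. *)
Let retr f : F := f - S (B (A f)).

Let retr_ghom : ghom retr.
Proof.
apply: ghom_add; first exact: ghom_id.
by apply/ghom_opp/(ghom_comp hS)/(ghom_comp hB)/hA.
Qed.

(** By [BAA] the subtracted term is [S (B (A f)) - S (A f)], which [S_rec] evaluates to [- A f]. *)
Let retrK f : retr (f - A f) = f.
Proof.
rewrite /retr (ghomB hA) (ghomB hB) (ghomB hS) BAA (S_rec (A f)).
set s := S (B (A f)); have -> : s - (A f + s) = - A f by rewrite opprD addrCA subrr addr0.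
by rewrite opprK subrK.
Qed.

Let proj f : F := f - (retr f - A (retr f)).

Let proj_ghom : ghom proj.
Proof.
apply: ghom_add; first exact: ghom_id.
apply/ghom_opp/ghom_add; first exact: retr_ghom.
by apply/ghom_opp/(ghom_comp hA)/retr_ghom.
Qed.

Let proj_kernel f : proj f \in kernel_pred retr_ghom.
Proof. by rewrite unfold_in /proj (ghomB retr_ghom) retrK subrr. Qed.

Lemma telescope_retract : exists (P : rgmod G) (i : P -> F) (pr : F -> P),
  [/\ ghom i, ghom pr, (forall x, pr (i x) = x), (forall f, pr (A f) = pr f) &
      forall f, B (A f) = 0 -> i (pr f) = A f].
Proof.
exists (kernel_rgmod retr_ghom), (@kernel_incl G F retr retr_ghom),
  (fun f => Kernel (proj_kernel f)); split=> [||x|f|f e].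
- exact: kernel_incl_ghom.
- split=> [x y|x g]; apply: val_inj => /=.
    exact: (ghomD proj_ghom).
  exact: (ghom_act proj_ghom).
- apply: val_inj; have := valP x; rewrite unfold_in => /eqP e.
  by rewrite /= /proj /kernel_incl e (ghom0 hA) !subr0.
- apply/esym/val_inj => /=; apply/eqP; rewrite -subr_eq0 -(ghomB proj_ghom).
  by rewrite /proj retrK subrr.
- rewrite /kernel_incl /= /proj; have -> : retr f = f by rewrite /retr e (ghom0 hS) subr0.
  by rewrite opprB addrC subrK.
Qed.

End Telescope.

(** * The projective module built on words *)

Section WhiteheadModule.
Variables (G : groupType) (d : nat) (h : 'I_d -> G).
Local Open Scope ring_scope.
Variable b : 'I_d -> 'I_d -> 'I_d -> seq (int * G).
Hypothesis bP : forall l (M : rgmod G) (m : M),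
  aug m (h l) = \sum_i \sum_j aug (aug (gract m (b l j i)) (h j)) (h i).

Definition words : choiceType := seq 'I_d.
Notation F := (free_rgmod G words).
Implicit Types (f : F) (w v : words).

Definition word_up : F -> F :=
  flift (fun w : words => \sum_i aug (fbasis G (i :: w : words)) (h i) : F).

Definition word_down : F -> F := flift (fun w : words =>
  if w is j :: i :: v then \sum_l gract (fbasis G (l :: v : words)) (b l j i) else 0 : F).

Lemma word_up_ghom : ghom word_up. Proof. exact: flift_ghom. Qed.
Lemma word_down_ghom : ghom word_down. Proof. exact: flift_ghom. Qed.

Lemma word_up_basis w : word_up (fbasis G w) = \sum_i aug (fbasis G (i :: w : words)) (h i).
Proof. exact: flift_basis. Qed.

Lemma word_down_basis w : word_down (fbasis G w) =
  if w is j :: i :: v then \sum_l gract (fbasis G (l :: v : words)) (b l j i) else 0.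
Proof. exact: flift_basis. Qed.

(** Two steps up from a word w give sum_ij (j i w) x_j x_i. Going down turns this into sum_lij (l w)
    b_lji x_j x_i, which is sum_l (l w) x_l by [bP]. *)
Lemma word_down_up_up f : word_down (word_up (word_up f)) = word_up f.
Proof.
have hl := ghom_comp word_down_ghom (ghom_comp word_up_ghom word_up_ghom).
apply: (free_ghom_ext hl word_up_ghom) => w.
rewrite word_up_basis (ghom_sum word_up_ghom) (ghom_sum word_down_ghom).
under eq_bigr => i _ do rewrite (aug_ghom _ _ word_up_ghom)
  (aug_ghom _ _ word_down_ghom) word_up_basis
  (ghom_sum word_down_ghom) aug_sum.
under [RHS]eq_bigr => l _ do rewrite bP.
rewrite [RHS]exchange_big; apply: eq_bigr => i _.
rewrite [RHS]exchange_big; apply: eq_bigr => j _.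
rewrite (aug_ghom _ _ word_down_ghom) word_down_basis -!aug_sum.
by [].
Qed.

Lemma iter_word_down_ghom k : ghom (iter k word_down).
Proof. elim: k => [|k IH]; [exact: ghom_id | exact: (ghom_comp word_down_ghom)]. Qed.

(* The inverse of 1 - word_down, a finite sum on every word since word_down
   shortens words. *)
Definition word_sum : F -> F :=
  flift (fun w : words => \sum_(k < (size w).+1) iter k word_down (fbasis G w)).

Lemma word_sum_ghom : ghom word_sum. Proof. exact: flift_ghom. Qed.

Lemma word_sum_basis w :
  word_sum (fbasis G w) = \sum_(k < (size w).+1) iter k word_down (fbasis G w).
Proof. exact: flift_basis. Qed.

(** The term k = 0 splits off. On words of length at least two [word_down] drops one letter, so the
    ranges of the remaining sums match; shorter words go to 0. *)
Lemma word_sum_rec f : word_sum f = f + word_sum (word_down f).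
Proof.
have hr := ghom_add (ghom_id _) (ghom_comp word_sum_ghom word_down_ghom).
apply: (free_ghom_ext word_sum_ghom hr) => w.
rewrite word_sum_basis big_ord_recl /=; congr (_ + _).
under eq_bigr => k _ do rewrite /bump /= -iterS iterSr.
rewrite word_down_basis; case: w => [|j [|i v]] /=.
- by rewrite big_ord0 (ghom0 word_sum_ghom).
- by rewrite big_ord1 /= (ghom0 word_sum_ghom).
rewrite (ghom_sum word_sum_ghom).
under eq_bigr => k _ do rewrite (ghom_sum (iter_word_down_ghom k)).
rewrite exchange_big; apply: eq_bigr => l _.
rewrite (gract_ghom _ _ word_sum_ghom) word_sum_basis /=.
under eq_bigr => k _ do rewrite (gract_ghom _ _ (iter_word_down_ghom k)).
by rewrite gract_sum.
Qed.

Lemma whitehead_module : exists (P : rgmod G) (i : P -> F) (pr : F -> P),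
  [/\ ghom i, ghom pr, (forall x, pr (i x) = x),
      (forall phi : P -> trivial_int G, ghom phi -> forall x, phi x = 0) &
      forall l, h l <> 1%g -> exists x : P, x != 0].
Proof.
have [P [i [pr [hi hpr prK prA iA]]]] :=
  telescope_retract word_up_ghom word_down_ghom word_sum_ghom word_down_up_up word_sum_rec.
exists P, i, pr; split=> // [phi hphi x|l hl].
  (* In [P] a word w equals sum_i (i w) x_i, and every x_i acts as zero on the trivial module. *)
  rewrite -[x]prK; move: (i x) => {x}.
  have hp := ghom_comp hphi hpr.
  have h0 : ghom (fun _ : F => 0 : trivial_int G) by split=> // *; rewrite addr0.
  apply: (free_ghom_ext hp h0) => w.
  rewrite -prA word_up_basis (ghom_sum hp) big1 // => j _.
  by rewrite (aug_ghom _ _ hp) /aug subrr.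
(* One-letter words go down to 0, so [i] sends the class of the empty word to [word_up] of that
   word. Its coefficient at [([:: l], h l)] is 1 because [h l] is not the identity. *)
exists (pr (fbasis G ([::] : words))); apply/eqP => /(congr1 i).
rewrite iA; last first.
  rewrite word_up_basis (ghom_sum word_down_ghom) big1 // => j _.
  by rewrite (aug_ghom _ _ word_down_ghom) word_down_basis aug0.
rewrite (ghom0 hi) word_up_basis => /(congr1 (mcoeff ([:: l] : words, h l))).
rewrite mcoeff0 raddf_sum (bigD1 l) //= big1 => [|j jl].
  rewrite /aug raddfB /= fractE mulgV !mcoeffU !xpair_eqE !eqxx /=.
  by rewrite [1%g == _]eq_sym; case: eqP => // _; rewrite mulr0n subr0 addr0.
rewrite /aug raddfB /= fractE !mcoeffU !xpair_eqE eqseq_cons (negPf jl) /=.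
by rewrite !mulr0n subr0.
Qed.

End WhiteheadModule.

Theorem mainTheorem9 (G : groupType) :
  polycyclic_by_finite G -> ~ polycyclic G ->
  exists P : rgmod G,
    [/\ projective P,
        (exists x : P, x != 0%R),
        (forall Q : P -> Prop, direct_summand Q -> fg_submodule Q ->
           forall x, Q x -> x = 0%R)
      & ~ free_module P].
Proof.
move=> pG npG; have [noG rf [//|[U [x [[sU pU] _ Ux x1]]]]] := polycyclic_by_finiteP pG.
have [l [lU lg]] := noG U sU (fun _ _ => I).
pose h (i : 'I_(size l)) := tnth (in_tuple l) i.
have hl y : y \in l -> exists i, h i = y by move=> /(tnthP (in_tuple l))[i ->]; exists i.
have hU i : U (h i) by apply/lU/mem_tnth.
(* Perfectness puts each generator in the derived subgroup, which supplies the coefficients [b]. *)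
have hb i := aug_perfect hl lg (pU _ (hU i)).
pose b i := proj1_sig (constructive_indefinite_description _ (hb i)).
have bP i := proj2_sig (constructive_indefinite_description _ (hb i)).
have [i hi] : exists i, h i <> 1%g.
  apply: NNPP => nh; apply: x1; elim: (lg x Ux) => // y g _ -> /hl[i <-].
  by rewrite mul1g; apply: NNPP => hi; apply: nh; exists i.
have [P [inc [pr [hinc hpr prK triv0 neq0]]]] := whitehead_module bP.
exists P; split.
- exact: free_retract_projective hinc hpr prK.
- exact: neq0 hi.
- by move=> Q; apply: (fg_summand_eq0 rf hinc hpr prK triv0).
- by apply: not_free_of_trivial_quotient0 => //; apply: neq0 hi.
Qed.
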